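(* Let $E$ be a Banach space and let $T\colon S\to\mathscr{L}(E)$ be a bounded representation of the commutative semigroup $S$. Then the following assertions are equivalent. (a) The semigroup at infinity $\mathscr{T}_\infty$ of $T$ is non-empty and operator norm compact. (b) Every subnet of the net $(T_s)_{s\in S}$ has a subnet that converges in operator norm. (c) The semigroup $\overline{T(S)}$ (closure in operator norm, with operator multiplication) contains an ideal that is compact in operator norm. (d) There exists a non-empty set $C\subseteq\mathscr{L}(E)$ that is relatively compact in operator norm and satisfies $\operatorname{dist}(T_s,C)\to0$ along the net $s\in S$. (e) $T$ is totally uniformly mean ergodic. (f) The unitary spectrum $\sigma_{\mathrm{uni}}(T)$ consists of poles of $T$. (g) There exists a decomposition $E=E_{\mathrm{r}}\oplus E_{\mathrm{s}}$ of $E$ into closed $T$-invariant subspaces such that $E_{\mathrm{r}}=\bigoplus_{k=1}^n\ker(\chi_k-T)$ for some $\chi_1,\dots,\chi_n\in S^{*,\mathrm{uni}}$, and the net $(T_s|_{E_{\mathrm{s}}})_{s\in S}$ converges to $0$ with respect to the operator norm.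
   Context: $(S,+)$ is a commutative semigroup with neutral element $0$; $S$ carries no topology and is not assumed cancellative. On $S$ we use the reflexive and transitive relation $s\le t$ iff there is $r\in S$ with $s+r=t$; it makes $S$ a directed set, and nets indexed by $S$ refer to it. All vector spaces are complex, and $\mathscr{L}(E)$ is the Banach algebra of bounded linear operators on $E$. A representation of $S$ in a unital Banach algebra $A$ is a map $T\colon S\to A$, $s\mapsto T_s$, with $T_{s+t}=T_sT_t$ for all $s,t\in S$ and $T_0=\mathbf{1}$ (the unit of $A$); it is bounded if $\sup_{s\in S}\|T_s\|<\infty$. A unitary semigroup character is a map $\chi\colon S\to\{z\in\mathbb{C}:|z|=1\}$ with $\chi(s+t)=\chi(s)\chi(t)$ and $\chi(0)=1$; the set of all these is $S^{*,\mathrm{uni}}$. For $\chi\in S^{*,\mathrm{uni}}$, $\chi T$ is the representation $s\mapsto\chi(s)T_s$. The unitary spectrum $\sigma_{\mathrm{uni}}(T)$ of a bounded representation $T\colon S\to A$ is the set of all $\chi\in S^{*,\mathrm{uni}}$ such that the left ideal of $A$ generated by $\{\chi(s)\mathbf{1}-T_s: s\in S\}$ is not equal to $A$ (so it is empty if $A=\{0\}$). For $T\colon S\to\mathscr{L}(E)$ and $\chi\in S^{*,\mathrm{uni}}$ put $\ker(\chi-T)=\{x\in E: T_sx=\chi(s)x\text{ for all }s\in S\}$. A subspace is $T$-invariant if it is invariant under all $T_s$; for a closed $T$-invariant subspace $F$, $T|_F\colon S\to\mathscr{L}(F)$ is the restricted representation $s\mapsto T_s|_F$. A character $\chi\in S^{*,\mathrm{uni}}$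 is a pole of $T$ if there is a projection $P\in\mathscr{L}(E)$ onto $\ker(\chi-T)$ with $PT_s=T_sP$ for all $s\in S$ and $\chi\notin\sigma_{\mathrm{uni}}(T|_{\ker P})$. $T$ is uniformly mean ergodic if the operator norm closed convex hull $\overline{\mathrm{co}}\,T(S)\subseteq\mathscr{L}(E)$ contains an element $P$ with $RP=PR=P$ for all $R\in\overline{\mathrm{co}}\,T(S)$; $T$ is totally uniformly mean ergodic if $\chi T$ is uniformly mean ergodic for every $\chi\in S^{*,\mathrm{uni}}$. The semigroup at infinity of $T$ is $\mathscr{T}_\infty=\bigcap_{s_0\in S}\overline{\{T_s: s\ge s_0\}}$, with closures in operator norm. An ideal of a commutative semigroup $C$ (written multiplicatively) is a non-empty subset $I\subseteq C$ with $cd\in I$ for all $c\in C$, $d\in I$. *)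

(* Defs.v *)
From HB Require Import structures.
From mathcomp Require Import all_boot all_order all_algebra.
From mathcomp Require Import all_classical all_reals all_analysis.
From mathcomp Require Import complex.
Set Implicit Arguments.
Unset Strict Implicit.
Unset Printing Implicit Defensive.
Import Order.TTheory GRing.Theory Num.Theory.
Import numFieldNormedType.Exports.
Local Open Scope classical_set_scope.
Local Open Scope ring_scope.
Local Open Scope complex_scope.

Section ComplexNorm.
Context {R : realType}.

Lemma ReK_real (z : R[i]) : 0 <= z -> (complex.Re z)%:C = z.
Proof. by move=> z0; rewrite RRe_real// ger0_real. Qed.

Lemma Re_addc (z w : R[i]) : complex.Re (z + w) = complex.Re z + complex.Re w.
Proof. by case: z => a b; case: w. Qed.

Lemma Re_lec (z w : R[i]) : z <= w -> complex.Re z <= complex.Re w.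
Proof. by case: z => a b; case: w => c d; rewrite lecE /= => /andP[]. Qed.

Lemma Re_mulc (z w : R[i]) : 0 <= z -> complex.Re (z * w) = complex.Re z * complex.Re w.
Proof.
by move=> /ReK_real <-; case: w => a b /=; rewrite mul0r subr0.
Qed.

End ComplexNorm.

Section BoundedOperators.
Context {R : realType}.
Local Notation C := (R[i]).
Variable E : normedModType C.

Definition bop_pred : {pred (E -> E)} :=
  [pred f : E -> E | `[< linear f /\ continuous f >]].

(* L(E): everywhere defined continuous linear maps, with composition as product;
   E may be the zero space, whence a ring in which 1 = 0 is allowed. *)
Record bop := Bop { bop_fun :> E -> E ; _ : bop_fun \in bop_pred }.
HB.instance Definition _ := [isSub for bop_fun].
HB.instance Definition _ := [Choice of bop by <:].

Lemma bop_pred_submod : subsemimod_closed bop_pred.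
Proof.
split; first split.
- apply/asboolP; split=> [a x y|x]; last exact: cst_continuous.
  by change (0 = a *: (0 : E) + 0); rewrite scaler0 addr0.
- move=> f g /asboolP[lf cf] /asboolP[lg cg]; apply/asboolP; split=> [a x y|x].
    change (f (a *: x + y) + g (a *: x + y) = a *: (f x + g x) + (f y + g y)).
    by rewrite lf lg scalerDr addrACA.
  by apply: continuousD; [exact: cf|exact: cg].
- move=> k f /asboolP[lf cf]; apply/asboolP; split=> [a x y|x].
    change (k *: f (a *: x + y) = a *: (k *: f x) + k *: f y).
    by rewrite lf scalerDr !scalerA mulrC.
  by apply: continuousZl_tmp; exact: cf.
Qed.
HB.instance Definition _ :=
  GRing.isSubmodClosed.Build C (E -> E) bop_pred bop_pred_submod.
HB.instance Definition _ := [SubChoice_isSubLmodule of bop by <:].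

Lemma bopP (f : bop) : linear f /\ continuous f.
Proof. by case: f => f /= /asboolP. Qed.

Lemma bop_eqP (f g : bop) : f =1 g -> f = g.
Proof. by move=> fg; apply: val_inj; apply/funext. Qed.

Lemma bop_addE (f g : bop) x : (f + g) x = f x + g x. Proof. by []. Qed.
Lemma bop_scaleE (k : C) (f : bop) x : (k *: f) x = k *: f x. Proof. by []. Qed.

Lemma bop_id_subproof : (@idfun E) \in bop_pred.
Proof. by apply/asboolP; split=> // x; exact: cvg_id. Qed.

Lemma bop_comp_subproof (f g : bop) : (f \o g) \in bop_pred.
Proof.
have [[lf cf] [lg cg]] := (bopP f, bopP g).
apply/asboolP; split=> [a x y|x]; first by rewrite /= lg lf.
by apply: continuous_comp; [exact: cg|exact: cf].
Qed.

Definition bop_one : bop := Bop bop_id_subproof.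
Definition bop_mul (f g : bop) : bop := Bop (bop_comp_subproof f g).

Lemma bop_mulA : associative bop_mul. Proof. by move=> f g h; exact: bop_eqP. Qed.
Lemma bop_mul1 : left_id bop_one bop_mul. Proof. by move=> f; exact: bop_eqP. Qed.
Lemma bop_mulr1 : right_id bop_one bop_mul. Proof. by move=> f; exact: bop_eqP. Qed.
Lemma bop_mulDl : left_distributive bop_mul +%R.
Proof. by move=> f g h; exact: bop_eqP. Qed.
Lemma bop_mulDr : right_distributive bop_mul +%R.
Proof.
move=> f g h; apply: bop_eqP => x; have [lf _] := bopP f.
change (f (g x + h x) = f (g x) + f (h x)).
by rewrite -[g x]scale1r lf !scale1r.
Qed.

HB.instance Definition _ := GRing.Zmodule_isPzRing.Build bop
  bop_mulA bop_mul1 bop_mulr1 bop_mulDl bop_mulDr.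

(* Norms over R[i] take values in R[i], so suprema and infima of norms are taken
   in R through complex.Re, which is faithful on the real elements of R[i]. *)
Definition opnorm (f : bop) : R :=
  sup [set complex.Re `|f x| | x in [set x : E | `|x| <= 1]].

Lemma bop0 (f : bop) : f 0 = 0.
Proof.
have [lf _] := bopP f.
by have := lf (-1) 0 0; rewrite scaler0 addr0 scaleN1r addNr.
Qed.

Lemma bopZ (f : bop) k x : f (k *: x) = k *: f x.
Proof.
have [lf _] := bopP f.
by have := lf k x 0; rewrite bop0 !addr0.
Qed.

Lemma opnorm_has_sup (f : bop) :
  has_sup [set complex.Re `|f x| | x in [set x : E | `|x| <= 1]].
Proof.
split; first by exists (complex.Re `|f 0|), 0 => //=; rewrite normr0.
have [lf cf] := bopP f.
pose g : {linear E -> E} := HB.pack (f : E -> E) (GRing.isLinear.Build _ _ _ _ _ lf).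
have cg : {for 0, continuous g} by exact: cf.
have /bounded_funP/(_ 1)[M fM] := @continuous_linear_bounded _ _ _ 0 g cg.
by exists (complex.Re M) => _ [x x1 <-]; apply: Re_lec; exact: fM.
Qed.

Lemma opnorm_ub (f : bop) x : `|x| <= 1 -> complex.Re `|f x| <= opnorm f.
Proof. by move=> x1; apply: (sup_upper_bound (opnorm_has_sup f)); exists x. Qed.

Lemma opnorm_ge0 f : 0 <= opnorm f.
Proof.
by have := @opnorm_ub f 0; rewrite bop0 normr0; apply; exact: ler01.
Qed.

Lemma opnorm_lub (f : bop) (M : R) :
  (forall x, `|x| <= 1 -> complex.Re `|f x| <= M) -> opnorm f <= M.
Proof.
move=> fM; apply: ge_sup; first exact: (opnorm_has_sup f).1.
by move=> _ [x x1 <-]; exact: fM.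
Qed.

Lemma opnormD (f g : bop) : (opnorm (f + g))%:C <= (opnorm f)%:C + (opnorm g)%:C.
Proof.
rewrite -rmorphD lecR; apply: opnorm_lub => x x1.
apply: (le_trans (Re_lec (ler_normD _ _))).
by rewrite Re_addc; apply: lerD; exact: opnorm_ub.
Qed.

Lemma opnormZ_le (k : C) (f : bop) : opnorm (k *: f) <= complex.Re `|k| * opnorm f.
Proof.
apply: opnorm_lub => x x1; rewrite bop_scaleE normrZ Re_mulc//.
by apply: ler_wpM2l; [exact: (Re_lec (normr_ge0 k))|exact: opnorm_ub].
Qed.

Lemma opnormZ (k : C) (f : bop) : (opnorm (k *: f))%:C = `|k| * (opnorm f)%:C.
Proof.
rewrite -[`|k|]ReK_real// -rmorphM; congr (_%:C).
apply/eqP; rewrite eq_le opnormZ_le andTb.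
have [->|k0] := eqVneq k 0; first by rewrite normr0 [complex.Re 0]/= mul0r opnorm_ge0.
have := opnormZ_le k^-1 (k *: f); rewrite scalerA mulVf// scale1r.
have kp : 0 < complex.Re `|k|.
  by move: (normr_gt0 k); rewrite k0 -[`|k|]ReK_real// ltcR.
rewrite normfV; have -> : complex.Re `|k|^-1 = (complex.Re `|k|)^-1.
  by rewrite -{1}[`|k|]ReK_real// -fmorphV.
by rewrite -ler_pdivlMl// ; rewrite invrK.
Qed.

Lemma opnorm_eq0 (f : bop) : (opnorm f)%:C = 0 -> f = 0.
Proof.
move=> [f0]; apply: bop_eqP => x.
have [->|x0] := eqVneq x 0; first by rewrite bop0.
have nx : `|x| != 0 by rewrite normr_eq0.
have : complex.Re `|f (`|x|^-1 *: x)| <= 0.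
  by rewrite -f0; apply: opnorm_ub; rewrite normrZ normfV normr_id mulVf.
rewrite -lecR ReK_real// normr_le0 bopZ scaler_eq0 invr_eq0 (negPf nx) /=.
by move/eqP.
Qed.

HB.instance Definition _ := Lmodule_isNormed.Build C bop
  opnormD opnormZ opnorm_eq0.

End BoundedOperators.

Section ClosedSubspaces.
Context {R : realType}.
Local Notation C := (R[i]).

Record closed_subspace (E : normedModType C) := ClosedSubspace {
  csub :> set E ;
  csub0 : csub 0 ;
  csubP : forall (a : C) x y, csub x -> csub y -> csub (a *: x + y) ;
  csub_closed : closed csub }.

Variables (E : normedModType C) (F : closed_subspace E).

Definition csub_pred : {pred E} := [pred x : E | `[< csub F x >]].

(* F as a normed space of its own, so that bop (subsp F) is L(F). *)
Record subsp := Subsp { subsp_val :> E ; _ : subsp_val \in csub_pred }.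
HB.instance Definition _ := [isSub for subsp_val].
HB.instance Definition _ := [Choice of subsp by <:].

Lemma csub_pred_submod : subsemimod_closed csub_pred.
Proof.
split; first split.
- by apply/asboolP; exact: csub0.
- move=> x y /asboolP Fx /asboolP Fy; apply/asboolP.
  by rewrite -[x]scale1r; exact: csubP.
- move=> a x /asboolP Fx; apply/asboolP.
  by rewrite -[a *: x]addr0; apply: csubP => //; exact: csub0.
Qed.
HB.instance Definition _ :=
  GRing.isSubmodClosed.Build C E csub_pred csub_pred_submod.
HB.instance Definition _ := [SubChoice_isSubLmodule of subsp by <:].

Definition subsp_norm (x : subsp) : C := `|subsp_val x|.
Lemma subsp_normD (x y : subsp) : subsp_norm (x + y) <= subsp_norm x + subsp_norm y.
Proof. exact: ler_normD. Qed.
Lemma subsp_normZ (a : C) (x : subsp) : subsp_norm (a *: x) = `|a| * subsp_norm x.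
Proof. exact: normrZ. Qed.
Lemma subsp_norm_eq0 (x : subsp) : subsp_norm x = 0 -> x = 0.
Proof. by move=> /normr0_eq0 x0; exact: val_inj. Qed.
HB.instance Definition _ := Lmodule_isNormed.Build C subsp
  subsp_normD subsp_normZ subsp_norm_eq0.

Lemma subspP (x : subsp) : csub F (subsp_val x).
Proof. by case: x => x /= /asboolP. Qed.

Variables (f : bop E) (fF : forall x, csub F x -> csub F (f x)).

Definition restr_fun (x : subsp) : subsp :=
  @Subsp (f (subsp_val x)) (asboolT (fF (subspP x))).

Lemma restr_subproof : restr_fun \in @bop_pred _ subsp.
Proof.
have [lf cf] := bopP f.
have lg : linear restr_fun by move=> a x y; apply: val_inj => /=; exact: lf.
apply/asboolP; split=> //.
pose f' : {linear E -> E} :=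
  HB.pack (f : E -> E) (GRing.isLinear.Build _ _ _ _ _ lf).
pose g : {linear subsp -> subsp} :=
  HB.pack restr_fun (GRing.isLinear.Build _ _ _ _ _ lg).
apply: (@bounded_linear_continuous _ _ _ g); apply/bounded_funP => r.
have cf' : {for 0, continuous f'} by exact: cf.
have /bounded_funP/(_ r)[M fM] := @continuous_linear_bounded _ _ _ 0 f' cf'.
by exists M => x xr; exact: fM.
Qed.
Definition restr : bop subsp := Bop restr_subproof.

End ClosedSubspaces.

Section Kernel.
Context {R : realType} {E : normedModType R[i]}.
Variable P : bop E.

Definition kerset : set E := [set x | P x = 0].
Lemma kerset0 : kerset 0.
Proof.
have [lP _] := bopP P.
by have := lP (-1) 0 0; rewrite scaler0 addr0 scaleN1r addNr.
Qed.
Lemma kersetP (a : R[i]) x y : kerset x -> kerset y -> kerset (a *: x + y).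
Proof.
by rewrite /kerset /= => x0 y0; rewrite (bopP P).1 x0 y0 scaler0 addr0.
Qed.
Lemma kerset_closed : closed kerset.
Proof.
have -> : kerset = P @^-1` [set 0] by [].
apply: preimage_closed; first by move=> x _; exact: (bopP P).2.
exact/accessible_closed_set1/hausdorff_accessible/norm_hausdorff.
Qed.
Definition ker_op : closed_subspace E :=
  ClosedSubspace kerset0 kersetP kerset_closed.
End Kernel.

Record directedType := DirectedType {
  dir_sort :> Type ;
  dle : dir_sort -> dir_sort -> Prop ;
  dir_inhabited : inhabited dir_sort ;
  dle_refl : forall i, dle i i ;
  dle_trans : forall i j k, dle i j -> dle j k -> dle i k ;
  dle_directed : forall i j, exists k, dle i k /\ dle j k }.

(* The filter of tails: a net x indexed by D converges to l iff
   x i @[i --> eventually_in D] --> l. *)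
Definition eventually_in (D : directedType) : set_system D :=
  filter_from setT (fun i : D => [set j | dle i j]).
Arguments eventually_in : clear implicits.

Global Instance eventually_in_filter (D : directedType) :
  ProperFilter (eventually_in D).
Proof.
apply: filter_from_proper => [|i _]; last by exists i; exact: dle_refl.
apply: filter_from_filter; first by case: (dir_inhabited D) => i; exists i.
move=> i j _ _; have [k [ik jk]] := dle_directed i j.
by exists k => // l kl; split; apply: dle_trans kl.
Qed.

(* Subnets in the sense of Kelley: phi need not be monotone. *)
Definition is_subnet (I J : directedType) (phi : J -> I) : Prop :=
  forall i : I, exists j0 : J, forall j : J, dle j0 j -> dle i (phi j).

Section Semigroup.
Variable S : nmodType.

Definition sle (s t : S) : Prop := exists r, s + r = t.

Lemma sle_refl s : sle s s. Proof. by exists 0; rewrite addr0. Qed.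
Lemma sle_trans s t u : sle s t -> sle t u -> sle s u.
Proof. by move=> [r <-] [q <-]; exists (r + q); rewrite addrA. Qed.
Lemma sle_directed s t : exists u, sle s u /\ sle t u.
Proof. by exists (s + t); split; [exists t|exists s; rewrite addrC]. Qed.

Definition sdir : directedType :=
  DirectedType (inhabits (0 : S)) sle_refl sle_trans sle_directed.

End Semigroup.

Definition left_ideal (A : pzRingType) (I : set A) : Prop :=
  [/\ I 0, forall x y, I x -> I y -> I (x + y) & forall a x, I x -> I (a * x)].

Section Representations.
Context {R : realType} {S : nmodType}.
Local Notation C := (R[i]).

Definition unitary_character (chi : S -> C) : Prop :=
  [/\ forall s, `|chi s| = 1,
      forall s t, chi (s + t) = chi s * chi t & chi 0 = 1].

Implicit Type E : normedModType C.

Definition representation E (T : S -> bop E) : Prop :=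
  (forall s t, T (s + t) = T s * T t) /\ T 0 = 1.

Definition twist E (chi : S -> C) (T : S -> bop E) : S -> bop E :=
  fun s => chi s *: T s.

(* Relative to the Banach algebra L(E). *)
Definition sigma_uni E (T : S -> bop E) : set (S -> C) :=
  [set chi | unitary_character chi /\
    smallest (@left_ideal (bop E)) (range (fun s => chi s *: (1 : bop E) - T s)) <> setT].

Definition ker_char E (chi : S -> C) (T : S -> bop E) : set E :=
  [set x | forall s, T s x = chi s *: x].

Definition rep_invariant E (T : S -> bop E) (F : set E) : Prop :=
  forall s x, F x -> F (T s x).

Definition restr_rep E (T : S -> bop E) (F : closed_subspace E)
    (TF : rep_invariant T F) : S -> bop (subsp F) :=
  fun s => restr (TF s).

Lemma ker_invariant E (T : S -> bop E) (P : bop E) :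
  (forall s, P * T s = T s * P) -> rep_invariant T (ker_op P).
Proof.
move=> PT s x /= Px; have := congr1 (fun f : bop E => f x) (PT s).
by move=> /= e; move: e Px; rewrite /kerset /= => -> ->; exact: (kerset0 (T s)).
Qed.

Definition pole E (T : S -> bop E) (chi : S -> C) : Prop :=
  unitary_character chi /\
  exists P : bop E, [/\ P * P = P, range P = ker_char chi T &
    exists PT : (forall s, P * T s = T s * P),
      ~ sigma_uni (restr_rep (ker_invariant PT)) chi].

(* The weights in {i01 R[i]} satisfy 0 <= t <= 1 for the partial order of R[i],
   hence are real. *)
Definition closed_convex_hull E (A : set (bop E)) : set (bop E) :=
  closure (smallest (@convex_set C (bop E)) A).

Definition uniformly_mean_ergodic E (T : S -> bop E) : Prop :=
  exists2 P, closed_convex_hull (range T) P &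
    forall Q, closed_convex_hull (range T) Q -> Q * P = P /\ P * Q = P.

Definition totally_uniformly_mean_ergodic E (T : S -> bop E) : Prop :=
  forall chi, unitary_character chi -> uniformly_mean_ergodic (twist chi T).

Definition semigroup_at_infinity E (T : S -> bop E) : set (bop E) :=
  \bigcap_(s0 in setT) closure (T @` [set s | sle s0 s]).

Definition semigroup_ideal E (G I : set (bop E)) : Prop :=
  [/\ I !=set0, I `<=` G & forall f g, G f -> I g -> I (f * g)].

Definition set_dist E (x : E) (A : set E) : R :=
  inf [set complex.Re `|x - y| | y in A].

(* W is the internal direct sum of the subspaces V i; the empty sum is {0}. *)
Definition is_direct_sum E (I : finType) (W : set E) (V : I -> set E) : Prop :=
  W = [set \sum_i v i | v in [set v : I -> E | forall i, V i (v i)]] /\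
  forall v : I -> E, (forall i, V i (v i)) ->
    \sum_i v i = 0 -> forall i, v i = 0.

End Representations.

(* Main.v *)
(* The implications (a) => (c) => (d) => (b) => (a) are direct net arguments.

   (d) => (e): by (d) the tails of T, and of every twist of T, have finite nets up to any
   eps, hence so do their convex hulls; an ultrafilter of almost invariant Cesaro means is
   therefore Cauchy and its limit is the mean ergodic projection.

   (e) => (f): the mean ergodic projection of the twist by 1/chi projects onto
   ker(chi - T), and on its kernel some convex combination of the twisted operators has
   norm < 1, which by a Neumann series puts 1 in the left ideal.

   (f) => (g): a bounded representation that does not converge to 0 has a unitary
   character of joint approximate eigenvectors.  Indeed all the norms are then >= 1, and
   left multiplication by T_s is isometric for the seminorm limsup_t |T_t B| on L(E);
   an averaging over roots of unity produces joint approximate eigenvectors of finitely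
   many commuting isometries, and compactness of the torus a character.  A pole admits no
   approximate eigenvectors in the kernel of its projection, so there are only finitely
   many eigencharacters, and T converges to 0 on the intersection of the kernels of their
   projections.

   (g) => (d): T_s is asymptotically the linear combination of the spectral projections
   with coefficients chi_k(s) in the torus. *)
From HB Require Import structures.
Require Import Defs.
From mathcomp Require Import all_boot all_order all_algebra.
From mathcomp Require Import cyclic separable cyclotomic.
From mathcomp Require Import all_classical all_reals all_analysis.
From mathcomp Require Import complex ring lra zify.
Import Order.TTheory GRing.Theory Num.Theory.
Import numFieldNormedType.Exports.
Set Implicit Arguments.
Unset Strict Implicit.
Unset Printing Implicit Defensive.
Local Open Scope classical_set_scope.
Local Open Scope ring_scope.
Local Open Scope complex_scope.

(** * Real-valued norms *)

Section RealNorm.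
Context {R : realType}.
Local Notation C := R[i].

(** The order of [R[i]] is partial, so norms are moved into [R], where the order is total and [lra]
    applies. *)
Definition rnorm (V : normedZmodType C) (x : V) : R := complex.Re `|x|.

Section zmod.
Variable V : normedZmodType C.
Implicit Types x y z : V.

Lemma rnormE x : (rnorm x)%:C = `|x|.
Proof. exact: (ReK_real (normr_ge0 x)). Qed.

Lemma rnorm_ge0 x : 0 <= rnorm x.
Proof. by rewrite -lecR rnormE; exact: normr_ge0. Qed.

Lemma rnorm0 : rnorm (0 : V) = 0.
Proof. by rewrite /rnorm normr0. Qed.

Lemma rnorm_eq0 x : (rnorm x == 0) = (x == 0).
Proof. by rewrite -(normr_eq0 x) -rnormE -(inj_eq (@complexI R)). Qed.

Lemma rnorm_gt0 x : (0 < rnorm x) = (x != 0).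
Proof. by rewrite lt_def rnorm_eq0 rnorm_ge0 andbT. Qed.

Lemma rnormN x : rnorm (- x) = rnorm x.
Proof. by rewrite /rnorm normrN. Qed.

Lemma rnormB_sym x y : rnorm (x - y) = rnorm (y - x).
Proof. by rewrite -rnormN opprB. Qed.

Lemma rnormD x y : rnorm (x + y) <= rnorm x + rnorm y.
Proof. by rewrite -lecR rmorphD /= !rnormE ler_normD. Qed.

Lemma rnormB x y : rnorm (x - y) <= rnorm x + rnorm y.
Proof. by rewrite -(rnormN y) rnormD. Qed.

Lemma rnorm_dist x y z : rnorm (x - z) <= rnorm (x - y) + rnorm (y - z).
Proof. by have := rnormD (x - y) (y - z); rewrite addrA subrK. Qed.

Lemma rnormBl x y : rnorm x <= rnorm (x - y) + rnorm y.
Proof. by have := rnormD (x - y) y; rewrite subrK. Qed.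

Lemma rnorm_sum (I : Type) (r : seq I) (P : pred I) (F : I -> V) :
  rnorm (\sum_(i <- r | P i) F i) <= \sum_(i <- r | P i) rnorm (F i).
Proof.
elim/big_rec2: _ => [|i a x _ ax]; first by rewrite rnorm0.
by apply: le_trans (rnormD _ _) _; rewrite lerD2l.
Qed.

Lemma rnorm_small0 x : (forall e : R, 0 < e -> rnorm x <= e) -> x = 0.
Proof.
move=> xe; apply/eqP; rewrite -rnorm_eq0 eq_le rnorm_ge0 andbT.
by apply/ler_addgt0Pr => e e0; rewrite add0r xe.
Qed.

End zmod.

Lemma rnorm1 : rnorm (1 : C) = 1. Proof. by rewrite /rnorm normr1. Qed.

Lemma rnormM (a b : C) : rnorm (a * b) = rnorm a * rnorm b.
Proof. by rewrite /rnorm normrM Re_mulc. Qed.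

Lemma rnormX (a : C) n : rnorm (a ^+ n) = rnorm a ^+ n.
Proof. by elim: n => [|n ih]; rewrite ?rnorm1// !exprS rnormM ih. Qed.

Lemma rnorm_real (r : R) : rnorm (r%:C : C) = `|r|.
Proof. by rewrite /rnorm normc_def /= expr0n addr0 sqrtr_sqr. Qed.

Lemma rnorm_nat n : rnorm (n%:R : C) = n%:R.
Proof. by rewrite -(rmorph_nat (real_complex R)) rnorm_real normr_nat. Qed.

Lemma unimodularE (a : C) : (`|a| = 1) <-> (rnorm a = 1).
Proof.
by rewrite -rnormE; split => [/(congr1 (@complex.Re R))//|->].
Qed.

Section mod.
Variable V : normedModType C.
Implicit Types x y z : V.

Lemma rnormZ (a : C) x : rnorm (a *: x) = rnorm a * rnorm x.
Proof. by rewrite /rnorm normrZ Re_mulc. Qed.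

Lemma nbhs_rnormP x (A : set V) :
  nbhs x A <-> exists2 e : R, 0 < e & forall y, rnorm (x - y) < e -> A y.
Proof.
split => [/nbhs_ballP[e /= e0]|[e e0 eA]].
  rewrite -ball_normE => eA.
  exists (complex.Re e) => [|y xy]; first by rewrite -ltcR ReK_real// ltW.
  by apply: eA => /=; rewrite -rnormE -(ReK_real (ltW e0)) ltcR.
apply/nbhs_ballP; exists e%:C => /=; first by rewrite ltcR.
by rewrite -ball_normE => y /=; rewrite -rnormE ltcR; exact: eA.
Qed.

Lemma cvg_rnormP (F : set_system V) (FF : Filter F) x :
  (F --> x) <-> forall e : R, 0 < e -> F [set y | rnorm (x - y) < e].
Proof.
split => [Fx e e0|H A /nbhs_rnormP[e e0 eA]].
  by apply: Fx; apply/nbhs_rnormP; exists e.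
by apply: filterS (H e e0).
Qed.

Lemma closure_rnormP (A : set V) x :
  closure A x <-> forall e : R, 0 < e -> exists2 y, A y & rnorm (x - y) < e.
Proof.
split => [cA e e0|H B /nbhs_rnormP[e e0 eB]].
  have /cA[y [Ay xy]] : nbhs x [set y | rnorm (x - y) < e].
    by apply/nbhs_rnormP; exists e.
  by exists y.
by have [y Ay xy] := H e e0; exists y; split => //; exact: eB.
Qed.

Lemma closed_rnormP (A : set V) :
  closed A <-> forall x, (forall e : R, 0 < e -> exists2 y, A y & rnorm (x - y) < e) -> A x.
Proof.
split=> [cA x H|H x /closure_rnormP]; last exact: H.
by apply: cA; apply/closure_rnormP.
Qed.

Lemma cluster_rnormP (F : set_system V) x :
  cluster F x <-> forall A (e : R), F A -> 0 < e -> exists2 y, A y & rnorm (x - y) < e.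
Proof.
rewrite clusterE; split => [H A e FA e0|H A FA].
  by have /closure_rnormP/(_ e e0) := H A FA.
by apply/closure_rnormP => e e0; exact: H.
Qed.

End mod.
End RealNorm.

(** * Bounded operators *)

Section OperatorNorm.
Context {R : realType}.
Local Notation C := R[i].

HB.instance Definition _ (E : normedModType C) (f : bop E) :=
  GRing.isLinear.Build C E E *:%R (bop_fun f) (bopP f).1.

Variable E : normedModType C.
Implicit Types (f g h : bop E) (x y : E).

Lemma bop_mulE f g x : (f * g) x = f (g x). Proof. by []. Qed.
Lemma bop_oneE x : (1 : bop E) x = x. Proof. by []. Qed.
Lemma bop_subE f g x : (f - g) x = f x - g x. Proof. by []. Qed.

Lemma bopD f x y : f (x + y) = f x + f y. Proof. exact: linearD. Qed.
Lemma bopB f x y : f (x - y) = f x - f y. Proof. exact: linearB. Qed.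

Lemma bop_sum f (I : Type) (r : seq I) (P : pred I) (F : I -> E) :
  f (\sum_(i <- r | P i) F i) = \sum_(i <- r | P i) f (F i).
Proof. exact: linear_sum. Qed.

Lemma bop_sumE (I : Type) (r : seq I) (P : pred I) (F : I -> bop E) x :
  (\sum_(i <- r | P i) F i) x = \sum_(i <- r | P i) F i x.
Proof. by elim/big_rec2: _ => // i _ f _ <-. Qed.

Lemma bop_scaleAl (a : C) f g : (a *: f) * g = a *: (f * g).
Proof. exact: bop_eqP. Qed.

Lemma bop_scaleAr (a : C) f g : f * (a *: g) = a *: (f * g).
Proof. by apply: bop_eqP => x; rewrite !bop_mulE !bop_scaleE linearZ. Qed.

Lemma rnorm_bop f x : rnorm (f x) <= rnorm f * rnorm x.
Proof.
have [->|x0] := eqVneq x 0; first by rewrite linear0 !rnorm0 mulr0.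
have nx : `|x| != 0 by rewrite normr_eq0.
have := @opnorm_ub _ _ f (`|x|^-1 *: x).
rewrite normrZ normfV normr_id mulVf// => /(_ (lexx _)).
rewrite -/(rnorm _) linearZ rnormZ -rnormE -fmorphV rnorm_real.
rewrite ger0_norm ?invr_ge0 ?rnorm_ge0// mulrC ler_pdivrMr// rnorm_gt0//.
Qed.

Lemma rnorm_bop_lub f (M : R) :
  0 <= M -> (forall x, rnorm (f x) <= M * rnorm x) -> rnorm f <= M.
Proof.
move=> M0 fM; apply: opnorm_lub => x x1; apply: (le_trans (fM x)).
by rewrite ler_piMr//; move: x1; rewrite -rnormE -[1]/(1%:C) lecR.
Qed.

Lemma rnorm_bopM f g : rnorm (f * g) <= rnorm f * rnorm g.
Proof.
apply: rnorm_bop_lub => [|x]; first by rewrite mulr_ge0 ?rnorm_ge0.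
apply: (le_trans (rnorm_bop f (g x))).
by rewrite -mulrA ler_wpM2l ?rnorm_ge0// rnorm_bop.
Qed.

Lemma rnorm_bop1 : rnorm (1 : bop E) <= 1.
Proof. by apply: rnorm_bop_lub => // x; rewrite mul1r. Qed.

Lemma rnorm_bop_witness f (c : R) : 0 <= c -> c < rnorm f ->
  exists2 x, x != 0 & c * rnorm x < rnorm (f x).
Proof.
move=> c0 cf; apply/not_exists2P => H.
suff : rnorm f <= c by rewrite leNgt cf.
apply: rnorm_bop_lub => // x; have [->|x0] := eqVneq x 0.
  by rewrite linear0 !rnorm0 mulr0.
by have [|/negP] := H x; rewrite ?x0// -leNgt.
Qed.

Lemma exists_bop (f : E -> E) (M : R) :
  linear f -> (forall x, rnorm (f x) <= M * rnorm x) -> exists g : bop E, g =1 f.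
Proof.
move=> lf fM.
pose f' : {linear E -> E} := HB.pack f (GRing.isLinear.Build _ _ _ _ _ lf).
suff cf : continuous f'.
  by exists (@Bop _ _ f (asboolT (conj lf cf))).
apply: (@bounded_linear_continuous _ _ _ f'); apply/bounded_funP => r.
exists (`|M| * complex.Re r)%:C => x xr; rewrite -rnormE lecR.
apply: (le_trans (fM x)); apply: (le_trans (ler_wpM2r (rnorm_ge0 x) (ler_norm M))).
by rewrite ler_wpM2l//; exact: Re_lec.
Qed.

End OperatorNorm.

(** * Completeness of the operator algebra and the Neumann series *)

Section BanachOperators.
Context {R : realType}.
Local Notation C := R[i].
Variable E : completeNormedModType C.

(** A Cauchy filter converges pointwise because [E] is complete. Its pointwise limit stays within
    [e * rnorm x] of a fixed operator at every [x]; this bounds the limit and turns pointwise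
    convergence into norm convergence. *)
Lemma bop_complete (F : set_system (bop E)) (FF : ProperFilter F) :
  (forall e : R, 0 < e -> exists L0, F [set f | rnorm (L0 - f) < e]) ->
  exists L : bop E, F --> L.
Proof.
move=> Fc.
have Fx x : cvg ((fun f : bop E => f x) @ F).
  apply: cauchy_cvg; apply: cauchy_exP => e e0.
  have r0 : 0 < complex.Re e by rewrite -ltcR ReK_real// ltW.
  have d0 : 0 < complex.Re e / (rnorm x + 1).
    by rewrite divr_gt0// ltr_wpDl// rnorm_ge0.
  have [L0 L0F] := Fc _ d0; exists (L0 x).
  change (F [set f | ball (L0 x) e (f x)]).
  apply: filterS L0F => f /= L0f; rewrite -ball_normE /=.
  rewrite -rnormE -(ReK_real (ltW e0)) ltcR -bop_subE.
  apply: le_lt_trans (rnorm_bop _ _) _.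
  have x1 : 0 < rnorm x + 1 by rewrite ltr_wpDl// rnorm_ge0.
  apply: (@le_lt_trans _ _ (rnorm (L0 - f) * (rnorm x + 1))).
    by rewrite ler_wpM2l ?rnorm_ge0// lerDl.
  by rewrite -ltr_pdivlMr.
pose L x := lim ((fun f : bop E => f x) @ F).
have FL x (e : R) : 0 < e -> F [set f | rnorm (L x - f x) < e].
  by move=> e0; have /cvg_rnormP := Fx x; exact.
have close (e : R) : 0 < e -> exists2 L0 : bop E,
    F [set f | rnorm (L0 - f) < e] & forall x, rnorm (L x - L0 x) <= e * rnorm x.
  move=> e0; have [L0 L0F] := Fc e e0; exists L0 => // x.
  apply/ler_addgt0Pr => d d0.
  have [f /= [fL fL0]] := filter_ex (filterI (FL x d d0) L0F).
  apply: le_trans (rnorm_dist _ (f x) _) _; rewrite addrC lerD ?(ltW fL)//.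
  rewrite rnormB_sym -bop_subE; apply: (le_trans (rnorm_bop _ _)).
  by rewrite ler_wpM2r ?rnorm_ge0// ltW.
have lL : linear L.
  move=> a x y; apply/eqP; rewrite -subr_eq0; apply/eqP/rnorm_small0 => e e0.
  (* The three approximation errors enter with weights 1, [rnorm a] and 1. *)
  have d0 : 0 < e / (rnorm a + 2).
    by rewrite divr_gt0// ltr_wpDl// rnorm_ge0.
  have [f /= [[f1 f2] f3]] := filter_ex (filterI (filterI
    (FL (a *: x + y) _ d0) (FL x _ d0)) (FL y _ d0)).
  have -> : L (a *: x + y) - (a *: L x + L y) =
      (L (a *: x + y) - f (a *: x + y)) - (a *: (L x - f x) + (L y - f y)).
    by rewrite (linearP f) scalerBr (addrACA (a *: L x)) -opprD opprB subrKA.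
  apply: le_trans (rnormB _ _) _.
  have := rnormD (a *: (L x - f x)) (L y - f y); rewrite rnormZ.
  have a0 := rnorm_ge0 a.
  have : rnorm a * rnorm (L x - f x) <= rnorm a * (e / (rnorm a + 2)).
    by rewrite ler_wpM2l// ltW.
  have : (rnorm a + 2) * (e / (rnorm a + 2)) = e by field; lra.
  move: f1 f2 f3 => /=; lra.
have [L0 _ LL0] := close 1 ltr01.
have [g gL] : exists g : bop E, g =1 L.
  apply: (@exists_bop _ _ _ (1 + rnorm L0)) => // x.
  apply: le_trans (rnormBl _ (L0 x)) _; rewrite mulrDl lerD//.
  exact: rnorm_bop.
exists g; apply/cvg_rnormP => e e0.
have e20 : 0 < e / 2 / 2 by rewrite !divr_gt0.
have [L1 FL1 LL1] := close _ e20; apply: filterS FL1 => f /= L1f.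
apply: le_lt_trans (rnorm_dist _ L1 _) _.
have : rnorm (g - L1) <= e / 2 / 2.
  by apply: rnorm_bop_lub => [|x]; [exact: ltW|rewrite bop_subE gL; exact: LL1].
lra.
Qed.

Lemma half_pow_lt (e : R) : 0 < e -> exists n, 2 * (1 / 2) ^+ n < e.
Proof.
move=> e0; exists (Num.bound (2 / e)); set n := Num.bound _.
have ne : 2 / e < n%:R by rewrite archi_boundP// divr_ge0// ltW.
have n2 : n%:R < 2 ^+ n :> R by rewrite -natrX ltr_nat ltn_expl.
rewrite expr_div_n expr1n mulrA mulr1 ltr_pdivrMr ?exprn_gt0// mulrC.
by rewrite -ltr_pdivrMr// (lt_trans ne).
Qed.

(** [W n] is the partial sum of the powers [Z ^+ k] with [k < n]. A left inverse is what membership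
    of 1 in a left ideal requires. *)
Lemma neumann_inverse (Z : bop E) :
  rnorm Z <= 1 / 2 -> exists W : bop E, W * (1 - Z) = 1.
Proof.
move=> Z2; pose W n := iter n (fun X : bop E => 1 + X * Z) 0.
have WZ n : W n.+1 = 1 + W n * Z by [].
have ZM (X : bop E) (c : R) : rnorm X <= c -> rnorm (X * Z) <= c / 2.
  move=> Xc; apply: (le_trans (rnorm_bopM _ _)).
  by rewrite -[_ / 2]mulr1 -mulrA [_ * 1]mulrC ler_pM ?rnorm_ge0.
have W2 n : rnorm (W n) <= 2.
  elim: n => [|n ih]; first by rewrite rnorm0.
  rewrite WZ; apply: (le_trans (rnormD _ _)).
  have := rnorm_bop1 E; have := ZM _ _ ih; lra.
have Wc n m : rnorm (W (n + m)%N - W n) <= 2 * (1 / 2) ^+ n.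
  elim: n => [|n ih]; first by rewrite subr0 expr0 mulr1.
  rewrite addSn !WZ opprD addrACA subrr add0r -mulrBl.
  by apply: le_trans (ZM _ _ ih) _; rewrite exprS; lra.
have [|L WL] := @bop_complete (W n @[n --> \oo]) _.
  move=> e e0; have [n ne] := half_pow_lt e0; exists (W n); exists n => // m /= nm.
  by rewrite rnormB_sym -(subnKC nm); apply: le_lt_trans (Wc _ _) ne.
exists L; apply/eqP; rewrite -subr_eq0; apply/eqP/rnorm_small0 => e e0.
have /cvg_rnormP Le := WL.
have e2 : 0 < e / 2 by rewrite divr_gt0.
have [n _ nL] := Le _ e2.
have Ln := nL n (leqnn _); have LSn := nL n.+1 (leqnSn _).
have -> : L * (1 - Z) - 1 = (L - W n.+1) - (L - W n) * Z.
  by rewrite WZ mulrBr mulr1 mulrBl opprD opprB (addrA L) subrKA addrAC.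
apply: (le_trans (rnormB _ _)).
have := ZM _ _ (ltW Ln); move: LSn; rewrite /=; lra.
Qed.

End BanachOperators.

(** * Approximate eigenvalues of isometries *)

(** As [n] is invertible, [X^n - 1] is separable and has [n] distinct roots, which form a cyclic
    group. *)
Lemma prim_root_exists (F : closedFieldType) n :
  n%:R != 0 :> F -> exists z : F, n.-primitive_root z.
Proof.
move=> n0; have n_gt0 : (0 < n)%N by case: n n0 => //; rewrite eqxx.
have [r Dp] := closed_field_poly_normal ('X^n - 1 : {poly F}).
rewrite (monicP (monicXnsubC 1 n_gt0)) scale1r in Dp.
have /hasP[z _ zn] : has n.-primitive_root r.
  apply: has_prim_root => //.
  - by apply/allP => z; rewrite -root_prod_XsubC -Dp.
  - by rewrite -separable_prod_XsubC -Dp separable_Xn_sub_1.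
  - by rewrite -ltnS -(size_prod_XsubC r id) -Dp size_XnsubC.
by exists z.
Qed.

Lemma sum_prim_root_expr (F : idomainType) n (z : F) e : n.-primitive_root z ->
  \sum_(m < n) z ^+ (m * e) = if (n %| e)%N then n%:R else 0.
Proof.
move=> zn; under eq_bigr do rewrite mulnC exprM.
rewrite (prim_order_dvd zn); case: eqP => [->|/eqP ze].
  under eq_bigr do rewrite expr1n.
  by rewrite sumr_const card_ord.
have := subrX1 (z ^+ e) n; rewrite -exprM mulnC exprM (prim_expr_order zn).
rewrite expr1n subrr => /esym/eqP; rewrite mulf_eq0 subr_eq0 (negPf ze).
by move=> /eqP.
Qed.

Section OneStep.
Context {R : realType}.
Local Notation C := R[i].
Variable X : normedModType C.
Variable p : bop X -> R.
Hypothesis p0 : forall B, 0 <= p B.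
Hypothesis pD : forall A B, p (A + B) <= p A + p B.
Hypothesis pZ : forall (a : C) B, p (a *: B) = rnorm a * p B.

Lemma seminorm_sum (I : Type) (r : seq I) (P : pred I) (F : I -> bop X) :
  p (\sum_(i <- r | P i) F i) <= \sum_(i <- r | P i) p (F i).
Proof.
elim/big_rec2: _ => [|i a x _ ax].
  by rewrite -[X in p X](scale0r (0 : bop X)) pZ rnorm0 mul0r.
by apply: le_trans (pD _ _) _; rewrite lerD2l.
Qed.

Lemma seminormN B : p (- B) = p B.
Proof. by rewrite -scaleN1r pZ rnormN rnorm1 mul1r. Qed.

Lemma seminormB A B : p (A - B) <= p A + p B.
Proof. by rewrite -(seminormN B) pD. Qed.

(** The quotient of [V ^+ L - z ^+ L] by [V - z]. *)
Definition geom (V : bop X) (z : C) L : bop X :=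
  \sum_(i < L) z ^+ i *: V ^+ (L.-1 - i).

Lemma geomM (V : bop X) (z : C) L :
  (V - z *: (1 : bop X)) * geom V z L = V ^+ L - z ^+ L *: (1 : bop X).
Proof.
have ze i : (z *: (1 : bop X)) ^+ i = z ^+ i *: (1 : bop X).
  elim: i => [|i ih]; first by rewrite scale1r.
  by rewrite exprS ih bop_scaleAl mul1r scalerA -exprS.
rewrite -ze subrXX_comm; last first.
  by rewrite /GRing.comm bop_scaleAl bop_scaleAr mul1r mulr1.
by congr (_ * _); apply: eq_bigr => i _; rewrite ze bop_scaleAr mulr1.
Qed.

Lemma geom_comm (U V : bop X) (z : C) L : U * V = V * U -> U * geom V z L = geom V z L * U.
Proof.
move=> UV; rewrite mulr_sumr mulr_suml; apply: eq_bigr => i _.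
by rewrite bop_scaleAl bop_scaleAr; congr (_ *: _); apply: commrX.
Qed.

(* Multiplied by [z ^+ L.+1], the power of [z] attached to the [(i, j)] term of the
   squared geometric sum is [L + 1 + i + j]; among these exponents only
   [2 L], reached by the [L] pairs with [i + j = L - 1], is a multiple of [2 L]. *)
Lemma geom_average (V : bop X) L (w : C) : (0 < L)%N -> (2 * L).-primitive_root w ->
  \sum_(m < 2 * L) (w ^+ m) ^+ L.+1 *: (geom V (w ^+ m) L * geom V (w ^+ m) L)
  = (2 * L * L)%:R *: V ^+ L.-1.
Proof.
move=> L0 wL.
transitivity (\sum_(m < 2 * L) \sum_(i < L) \sum_(j < L)
    w ^+ (m * (L.+1 + (i + j))) *: V ^+ (L.-1 - i + (L.-1 - j))).
  apply: eq_bigr => m _; rewrite mulr_suml scaler_sumr; apply: eq_bigr => i _.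
  rewrite mulr_sumr scaler_sumr; apply: eq_bigr => j _.
  by rewrite bop_scaleAl bop_scaleAr !scalerA -!exprD -exprM addnA.
rewrite exchange_big natrM /=.
transitivity (\sum_(i < L) (2 * L)%:R *: V ^+ L.-1); last first.
  by rewrite sumr_const card_ord -scaler_nat scalerA mulrC.
apply: eq_bigr => i _; rewrite exchange_big /=.
under eq_bigr do rewrite -scaler_suml (sum_prim_root_expr _ wL).
rewrite (bigD1 (rev_ord i))//= big1 ?addr0 => [|j ji].
  have -> : (L.+1 + (i + (L - i.+1)) = 2 * L)%N by have := ltn_ord i; lia.
  by rewrite dvdnn; congr (_ *: V ^+ _); have := ltn_ord i; lia.
case: ifP => [/dvdnP[k]|]; last by rewrite scale0r.
have := ltn_ord i; have := ltn_ord j.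
move: ji; rewrite -(inj_eq val_inj)/= => ji iL jL.
case: k => [|[|k]]; [lia|move: ji => /eqP; lia|nia].
Qed.

(* For a good root of unity [z] and [G := geom V z L] one has [p (G^2 B) >= L p B],
   whereas [p ((V - z)^2 G^2 B) = p ((V^L - z^L)^2 B) <= 4 p B]: for large [L], one of
   [G^2 B] and [(V - z) G^2 B] is an approximate eigenvector. *)
Lemma one_step (e : R) : 0 < e -> exists2 K : R, 0 < K &
  forall V B : bop X, (forall A, p (V * A) = p A) -> 0 < p B ->
  exists (z : C) (H : bop X), [/\ rnorm z = 1,
    (forall U, U * V = V * U -> U * H = H * U),
    (forall A, p (H * A) <= K * p A),
    p B <= p (H * B) &
    p ((V - z *: (1 : bop X)) * (H * B)) <= e * p (H * B)].
Proof.
move=> e0; pose L := (Num.bound (4 / e ^+ 2 + 1 / e)).+1.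
have L1 : 1 <= L%:R :> R by rewrite ler1n.
(* If [(V - z) G^2 B] is the vector chosen, the first bound keeps it no smaller than [B] and the
   second absorbs the factor 4 in its error. *)
have [Le1 Le2] : 1 <= e * L%:R /\ 4 <= e ^+ 2 * L%:R.
  have : 4 / e ^+ 2 + 1 / e < L%:R.
    apply: lt_le_trans (archi_boundP _) _; last by rewrite ler_nat.
    by rewrite addr_ge0// divr_ge0// ?exprn_ge0// ltW.
  have h4 : 0 < 4 / e ^+ 2 by rewrite divr_gt0 ?exprn_gt0.
  have h1 : 0 < 1 / e by rewrite divr_gt0.
  move=> LL; split; rewrite mulrC -ler_pdivrMr ?exprn_gt0//; lra.
(* The larger candidate for [H] has bound 2 for [V - z] times [L] for each of the two factors
   [G]. *)
exists (2 * L%:R ^+ 2) => [|V B pV pB]; first by rewrite mulr_gt0// exprn_gt0//; lra.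
have pVn n A : p (V ^+ n * A) = p A.
  by elim: n => [|n ih]; rewrite ?mul1r// exprS -mulrA pV.
have pG (z : C) A : rnorm z = 1 -> p (geom V z L * A) <= L%:R * p A.
  move=> z1; rewrite mulr_suml; apply: (le_trans (seminorm_sum _ _ _)).
  under eq_bigr do rewrite bop_scaleAl pZ rnormX z1 expr1n mul1r pVn.
  by rewrite sumr_const card_ord mulr_natl.
have [w wL] : exists w : C, (2 * L).-primitive_root w.
  by apply: prim_root_exists; rewrite pnatr_eq0.
have w1 m : rnorm (w ^+ m) = 1.
  rewrite rnormX; suff -> : rnorm w = 1 by rewrite expr1n.
  apply/eqP; rewrite -(@pexpr_eq1 _ _ (2 * L)) ?rnorm_ge0//.
  by rewrite -rnormX (prim_expr_order wL) rnorm1.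
have [m mL] : exists m : 'I_(2 * L), L%:R * p B <=
    p (geom V (w ^+ m) L * geom V (w ^+ m) L * B).
  (* If every root of unity failed, averaging by [geom_average] would give
     [p (V ^+ L.-1 * B) < p B], although [V] is isometric for [p]. *)
  apply/not_existsP => H.
  have : p ((2 * L * L)%:R *: V ^+ L.-1 * B) < (2 * L * L)%:R * p B.
    rewrite -(geom_average V _ wL)// mulr_suml; apply: (le_lt_trans (seminorm_sum _ _ _)).
    apply: (@lt_le_trans _ _ (\sum_(m < 2 * L) L%:R * p B)); last first.
      by rewrite sumr_const card_ord -[_ *+ (2 * L)]mulr_natl mulrA -natrM.
    apply: ltr_sum => [|m _].
      have L0 : (0 < 2 * L)%N by rewrite muln_gt0.
      by apply/hasP; exists (Ordinal L0).
    by rewrite bop_scaleAl pZ rnormX w1 expr1n mul1r ltNge; apply/negP/H.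
  by rewrite bop_scaleAl pZ pVn rnorm_nat ltxx.
have {w1}z1 := w1 m; move: (w ^+ m) z1 mL => {w wL m} z z1 GB.
set G := geom V z L in GB *; set D := V - z *: (1 : bop X).
have GU U : U * V = V * U -> U * G = G * U by exact: geom_comm.
have DU U : U * V = V * U -> U * D = D * U.
  by move=> UV; rewrite mulrBr mulrBl UV bop_scaleAl bop_scaleAr mul1r mulr1.
have pDA A : p (D * A) <= 2 * p A.
  rewrite mulrBl; apply: (le_trans (seminormB _ _)).
  by rewrite pV bop_scaleAl mul1r pZ z1; lra.
have pGG A : p (G * G * A) <= L%:R ^+ 2 * p A.
  rewrite -mulrA; apply: (le_trans (pG _ _ z1)).
  by rewrite expr2 -mulrA ler_wpM2l// pG.
have DDGG : p (D * (D * (G * G * B))) <= 4 * p B.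
  have -> : D * (D * (G * G * B)) = D * G * (D * G * B).
    by rewrite !mulrA -(mulrA D G D) (DU G) ?mulrA// -GU.
  have DG A : p (D * G * A) <= 2 * p A.
    rewrite geomM mulrBl; apply: (le_trans (seminormB _ _)).
    by rewrite pVn bop_scaleAl mul1r pZ rnormX z1 expr1n; lra.
  by have := DG (D * G * B); have := DG B; lra.
have pB0 := p0 B.
have L2 : L%:R * p B * 1 <= L%:R * p B * L%:R by rewrite ler_wpM2l// mulr_ge0.
have [DG|DG] := leP (p (D * (G * G * B))) (e * p (G * G * B)).
  exists z, (G * G); split => //.
  - by move=> U UV; rewrite mulrA (GU U)// -mulrA (GU U)// mulrA.
  - move=> A; apply: (le_trans (pGG A)); rewrite ler_wpM2r//.
    by rewrite ler_peMl ?sqr_ge0 ?ler1n.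
  - by apply: le_trans GB; rewrite ler_peMl.
exists z, (D * (G * G)); split => //.
- by move=> U UV; rewrite !mulrA (DU U)// -(mulrA D U) (GU U)// mulrA -mulrA (GU U)// mulrA.
- by move=> A; rewrite -mulrA -mulrA; apply: (le_trans (pDA _)); rewrite -mulrA ler_wpM2l// mulrA.
- rewrite -mulrA; apply: le_trans (ltW DG).
  apply: (@le_trans _ _ (e * (L%:R * p B))); last by rewrite ler_wpM2l// ltW.
  by rewrite mulrA ler_peMl.
- rewrite -(mulrA D); apply: (le_trans DDGG).
  apply: (@le_trans _ _ (e * (e * (L%:R * p B)))).
    by rewrite 2!mulrA -expr2 ler_wpM2r.
  rewrite ler_wpM2l ?(ltW e0)//; apply: le_trans (ltW DG).
  by rewrite ler_wpM2l// ltW.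
Qed.
End OneStep.

(** * Joint approximate eigenvectors *)

Section JointApproximate.
Context {R : realType} {S : nmodType}.
Local Notation C := R[i].
Variable X : normedModType C.
Variable p : bop X -> R.
Hypothesis p0 : forall B, 0 <= p B.
Hypothesis pD : forall A B, p (A + B) <= p A + p B.
Hypothesis pZ : forall (a : C) B, p (a *: B) = rnorm a * p B.
Variable T : S -> bop X.
Hypothesis TC : forall s t, T s * T t = T t * T s.
Hypothesis pT : forall s B, p (T s * B) = p B.

(** Induction on [l]. The operator [H] that adds the next [s] commutes with every [T u] and has a
    bound [K] depending only on [e], so the earlier errors survive if they are first made as small
    as [e / K]. *)
Lemma joint_seminorm_eigen (B0 : bop X) (l : seq S) (e : R) : 0 < p B0 -> 0 < e ->
  exists2 z : S -> C, (forall s, rnorm (z s) = 1) & exists2 B, 0 < p B &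
    forall s, s \in l -> p ((T s - z s *: (1 : bop X)) * B) <= e * p B.
Proof.
move=> pB0; elim: l e => [|s l ih] e e0.
  by exists (fun=> 1) => [_|]; [exact: rnorm1|exists B0].
have [K K0 step] := one_step p0 pD pZ e0.
have [z z1 [B pB zB]] := ih (e / K) (divr_gt0 e0 K0).
have [w [H [w1 HC HK HB Hw]]] := step (T s) B (pT s) pB.
exists (fun u => if u == s then w else z u) => [u|]; first by case: ifP.
exists (H * B) => [|u]; first exact: lt_le_trans HB.
rewrite inE; case: eqP => [->//|_] /= ul.
rewrite mulrA HC; last by rewrite mulrBr mulrBl TC bop_scaleAl bop_scaleAr mulr1 mul1r.
rewrite -mulrA; apply: (le_trans (HK _)).
apply: (@le_trans _ _ (K * (e / K * p B))); first by rewrite ler_wpM2l ?(ltW K0) ?zB.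
have -> : K * (e / K * p B) = e * p B by field; rewrite gt_eqF.
by rewrite ler_wpM2l// ltW.
Qed.
End JointApproximate.

(** * The limsup seminorm of a bounded representation and its approximate eigenvectors *)

Section StableSeminorm.
Context {R : realType} {S : nmodType}.
Local Notation C := R[i].
Variable X : normedModType C.
Variable T : S -> bop X.
Hypothesis Trep : representation T.
Variable M : R.
Hypothesis TM : forall s, rnorm (T s) <= M.
Implicit Types A B : bop X.

Lemma rep_comm s t : T s * T t = T t * T s.
Proof. by rewrite -!Trep.1 addrC. Qed.

Lemma rep_bound_ge0 : 0 <= M.
Proof. exact: le_trans (rnorm_ge0 _) (TM 0). Qed.

(** The usual renorming: an equivalent norm for which left multiplication by every [T t] is a
    contraction. *)
Definition orbit_norm B : R := sup [set rnorm (T t * B) | t in setT].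
Local Notation h := orbit_norm.

Lemma orbit_norm_ub t B : rnorm (T t * B) <= h B.
Proof.
apply: ub_le_sup; last by exists t.
exists (M * rnorm B) => _ [u _ <-]; apply: (le_trans (rnorm_bopM _ _)).
by rewrite ler_wpM2r ?rnorm_ge0.
Qed.

Lemma orbit_norm_lub B c : (forall t, rnorm (T t * B) <= c) -> h B <= c.
Proof. by move=> Bc; apply: ge_sup; [exists (rnorm (T 0 * B)), 0|move=> _ [t _ <-]]. Qed.

Lemma orbit_norm_ge B : rnorm B <= h B.
Proof. by have := orbit_norm_ub 0 B; rewrite Trep.2 mul1r. Qed.

Lemma orbit_norm_ge0 B : 0 <= h B.
Proof. exact: le_trans (rnorm_ge0 _) (orbit_norm_ge B). Qed.

Lemma orbit_normT s B : h (T s * B) <= h B.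
Proof. by apply: orbit_norm_lub => t; rewrite mulrA -Trep.1 orbit_norm_ub. Qed.

Lemma orbit_normD A B : h (A + B) <= h A + h B.
Proof.
apply: orbit_norm_lub => t; rewrite mulrDr; apply: (le_trans (rnormD _ _)).
by rewrite lerD ?orbit_norm_ub.
Qed.

Lemma orbit_normZ_le (a : C) B : h (a *: B) <= rnorm a * h B.
Proof.
apply: orbit_norm_lub => t.
by rewrite bop_scaleAr rnormZ ler_wpM2l ?rnorm_ge0 ?orbit_norm_ub.
Qed.

(* The limsup over [s] of the norm of [T s * B]; multiplication by [T s] is isometric
   for it. *)
Definition stable_norm B : R := inf [set h (T s * B) | s in setT].
Local Notation p := stable_norm.

Let has_inf_h B : has_inf [set h (T s * B) | s in setT].
Proof.
split; first by exists (h (T 0 * B)), 0.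
by exists 0 => _ [s _ <-]; exact: orbit_norm_ge0.
Qed.

Lemma stable_norm_le s B : p B <= h (T s * B).
Proof. by apply: (inf_lbound (has_inf_h B).2); exists s. Qed.

Lemma stable_norm_glb B c : (forall s, c <= h (T s * B)) -> c <= p B.
Proof. by move=> cB; apply: lb_le_inf (has_inf_h B).1 _ => _ [s _ <-]. Qed.

Lemma stable_norm_adh B e : 0 < e -> exists s, h (T s * B) < p B + e.
Proof. by move=> e0; have [_ [s _ <-]] := inf_adherent e0 (has_inf_h B); exists s. Qed.

Lemma stable_norm_ge0 B : 0 <= p B.
Proof. by apply: stable_norm_glb => s; exact: orbit_norm_ge0. Qed.

(** By [orbit_normT] both infima can be approached at the common index [s + t]. *)
Lemma stable_normD A B : p (A + B) <= p A + p B.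
Proof.
apply/ler_addgt0Pr => e e0; have e2 : 0 < e / 2 by rewrite divr_gt0.
have [[s sA] [t tB]] := (stable_norm_adh A e2, stable_norm_adh B e2).
have := stable_norm_le (s + t) (A + B); rewrite mulrDr => /le_trans.
move=> /(_ _ (orbit_normD _ _)).
rewrite {1}addrC !Trep.1 -!mulrA.
have := orbit_normT t (T s * A); have := orbit_normT s (T t * B); lra.
Qed.

Let stable_normZ_le (a : C) B : p (a *: B) <= rnorm a * p B.
Proof.
apply/ler_addgt0Pr => e e0.
have a1 : 0 < rnorm a + 1 by rewrite ltr_wpDl ?rnorm_ge0.
have d0 : 0 < e / (rnorm a + 1) by rewrite divr_gt0.
have [s sB] := stable_norm_adh B d0; apply: (le_trans (stable_norm_le s _)).
rewrite bop_scaleAr; apply: (le_trans (orbit_normZ_le _ _)).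
apply: (@le_trans _ _ (rnorm a * (p B + e / (rnorm a + 1)))).
  by rewrite ler_wpM2l ?rnorm_ge0// ltW.
rewrite mulrDr lerD2l mulrA ler_pdivrMr// mulrC ler_wpM2l ?(ltW e0)//; lra.
Qed.

Lemma stable_normZ (a : C) B : p (a *: B) = rnorm a * p B.
Proof.
have [->|a0] := eqVneq a 0.
  apply/eqP; rewrite eq_le stable_normZ_le rnorm0 mul0r; exact: stable_norm_ge0.
apply/eqP; rewrite eq_le stable_normZ_le andTb.
have := stable_normZ_le a^-1 (a *: B); rewrite scalerA mulVf// scale1r.
move=> /(ler_wpM2l (rnorm_ge0 a)).
by rewrite mulrA -rnormM mulfV// rnorm1 mul1r.
Qed.

Lemma stable_normT s B : p (T s * B) = p B.
Proof.
apply/eqP; rewrite eq_le; apply/andP; split; apply: stable_norm_glb => t.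
  apply: (le_trans (stable_norm_le t _)).
  by rewrite mulrA rep_comm -mulrA; exact: orbit_normT.
by rewrite mulrA -Trep.1; exact: stable_norm_le.
Qed.

Definition approx_eigen (z : S -> C) := forall (l : seq S) (e : R), 0 < e ->
  exists2 x, x != 0 & forall s, s \in l -> rnorm (T s x - z s *: x) <= e * rnorm x.

(** If [rnorm (T s) < 1] for one [s], then every index beyond [s *+ n] has norm at most
    [M * rnorm (T s) ^+ n]. *)
Lemma cvg0_or_norm_ge1 : T s @[s --> eventually_in (sdir S)] --> (0 : bop X) \/
  forall s, 1 <= rnorm (T s).
Proof.
have [H|/existsNP[s /negP]] := pselect (forall s, 1 <= rnorm (T s)); first by right.
rewrite -ltNge => s1; left; apply/cvg_rnormP => e e0.
have M0 := rep_bound_ge0.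
have [n ne] : exists n, M * rnorm (T s) ^+ n < e.
  have r1 : `|rnorm (T s)| < 1 by rewrite ger0_norm ?rnorm_ge0.
  have /cvgrPdist_lt/(_ e e0)[n _ /(_ n (leqnn _))] := cvg_geometric M r1.
  rewrite sub0r normrN /geometric /= ger0_norm ?mulr_ge0 ?exprn_ge0 ?rnorm_ge0//.
  by exists n.
exists (s *+ n) => // u [r <-] /=; rewrite sub0r rnormN addrC Trep.1.
apply: le_lt_trans ne; apply: (le_trans (rnorm_bopM _ _)).
rewrite ler_pM ?rnorm_ge0//; elim: n => [|n ih].
  by rewrite mulr0n Trep.2 rnorm_bop1.
rewrite mulrS Trep.1 exprS; apply: (le_trans (rnorm_bopM _ _)).
by rewrite ler_wpM2l ?rnorm_ge0.
Qed.

(** Since [p 1 >= 1], there is an operator [B] that is an approximate eigenvector for [p]. It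
    becomes a vector by moving along the orbit until the orbit norms of the errors are near their
    [p], and evaluating where the operator is large. *)
Lemma joint_approx_vector (l : seq S) (e : R) :
  (forall s, 1 <= rnorm (T s)) -> 0 < e ->
  exists2 z : S -> C, (forall s, rnorm (z s) = 1) & exists2 x, x != 0 &
    forall s, s \in l -> rnorm (T s x - z s *: x) <= e * rnorm x.
Proof.
move=> T1 e0.
have p1 : 0 < p 1.
  apply: lt_le_trans ltr01 _; apply: stable_norm_glb => s; rewrite mulr1.
  exact: le_trans (orbit_norm_ge _).
have e4 : 0 < e / 4 by rewrite divr_gt0.
have [z z1 [B pB zB]] := joint_seminorm_eigen stable_norm_ge0 stable_normD
  stable_normZ rep_comm stable_normT l p1 e4.
exists z => //.
(* One [u] serves the whole list, because adding indices never increases an orbit norm. The bound is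
   [e / 4] from [zB] plus [e / 4] of slack. *)
have [u ul] : exists u, forall s, s \in l ->
    h (T u * ((T s - z s *: (1 : bop X)) * B)) <= e / 2 * p B.
  elim: l zB => [|s l ih] zB; first by exists 0.
  have [|u ul] := ih; first by move=> t tl; rewrite zB// inE tl orbT.
  have d0 : 0 < e / 4 * p B by rewrite mulr_gt0.
  have := zB s (mem_head _ _); set Y := _ * B => pY.
  have [v vs] := stable_norm_adh Y d0.
  exists (u + v) => t; rewrite inE => /orP[/eqP ->|tl].
    rewrite Trep.1 -mulrA -/Y; apply: le_trans (orbit_normT _ _) _.
    apply: (le_trans (ltW vs)); move: pY; lra.
  rewrite addrC Trep.1 -mulrA; apply: le_trans (orbit_normT _ _) _; exact: ul.
have [t tB] : exists t, p B / 2 < rnorm (T t * (T u * B)).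
  apply/not_existsP => H; have : h (T u * B) <= p B / 2.
    by apply: orbit_norm_lub => t; rewrite leNgt; apply/negP/H.
  have := stable_norm_le u B; lra.
have pB2 : 0 <= p B / 2 by rewrite divr_ge0// ltW.
have [x x0 xB] := rnorm_bop_witness pB2 tB.
exists (T t (T u (B x))).
  rewrite -rnorm_gt0; apply: le_lt_trans xB; rewrite mulr_ge0 ?rnorm_ge0//.
move=> s sl.
have -> : T s (T t (T u (B x))) - z s *: T t (T u (B x)) =
    (T t * (T u * ((T s - z s *: (1 : bop X)) * B))) x.
  have c a b y : T a (T b y) = T b (T a y) by rewrite -bop_mulE rep_comm.
  rewrite (c s t) (c s u) !bop_mulE bop_subE bop_scaleE bop_oneE.
  by rewrite (linearB (T u)) (linearB (T t)) (linearZ_LR (T u)) (linearZ_LR (T t)).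
apply: (le_trans (rnorm_bop _ _)).
apply: (@le_trans _ _ (e / 2 * p B * rnorm x)).
  rewrite ler_wpM2r ?rnorm_ge0//; apply: le_trans (ul _ sl); exact: orbit_norm_ub.
have : e * (p B / 2 * rnorm x) <= e * rnorm (T t (T u (B x))).
  by rewrite ler_wpM2l ?ltW.
lra.
Qed.
End StableSeminorm.

(** * Compactness of the torus *)

Section ComplexCompact.
Context {R : realType}.
Local Notation C := R[i].

Lemma rnorm_Re_le (z : C) : `|complex.Re z| <= rnorm z.
Proof.
case: z => a b; rewrite /rnorm normc_def /= -(sqrtr_sqr a) ler_wsqrtr//.
by rewrite lerDl sqr_ge0.
Qed.

Lemma rnorm_Im_le (z : C) : `|complex.Im z| <= rnorm z.
Proof.
case: z => a b; rewrite /rnorm normc_def /= -(sqrtr_sqr b) ler_wsqrtr//.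
by rewrite lerDr sqr_ge0.
Qed.

Lemma rnorm_le_ReIm (z : C) : rnorm z <= `|complex.Re z| + `|complex.Im z|.
Proof.
case: z => a b; rewrite /rnorm normc_def /=.
rewrite -(ler_pXn2r (n := 2))// ?nnegrE ?sqrtr_ge0 ?addr_ge0//.
rewrite sqr_sqrtr ?addr_ge0 ?sqr_ge0// sqrrD !real_normK ?num_real//.
by rewrite addrAC lerDl mulrn_wge0// mulr_ge0.
Qed.

Lemma compact_disc : compact [set z : C^o | rnorm z <= 1].
Proof.
pose f (u : R * R) : C^o := (u.1 +i* u.2)%C.
have cf : continuous f.
  move=> u; apply/cvg_rnormP => e e0.
  have e2 : 0 < e / 2 by rewrite divr_gt0.
  exists (ball u.1 (e / 2), ball u.2 (e / 2)).
    by split; apply: nbhsx_ballx.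
  move=> [a b] /= [ua ub]; apply: le_lt_trans (rnorm_le_ReIm _) _.
  by rewrite /=; move: ua ub; rewrite -!ball_normE /=; lra.
apply: (@subclosed_compact _ _ (f @` (`[-1, 1] `*` `[-1, 1]))).
- apply/closed_rnormP => x H; apply/ler_addgt0Pr => e e0.
  have [y /= y1 xy] := H e e0.
  by apply: le_trans (rnormBl x y) _; rewrite addrC lerD// ltW.
- apply: continuous_compact; first exact: continuous_subspaceT.
  by apply: compact_setX; exact: segment_compact.
- move=> z /= z1; exists (complex.Re z, complex.Im z); last by case: z z1.
  have := rnorm_Re_le z; have := rnorm_Im_le z.
  by split; rewrite /= in_itv /= -ler_norml; lra.
Qed.

Lemma closed_circle : closed [set z : C^o | rnorm z = 1].
Proof.
apply/closed_rnormP => x H; apply/eqP; rewrite eq_le; apply/andP.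
split; apply/ler_addgt0Pr => e e0; have [y /= y1 xy] := H e e0.
  have := rnormBl x y; lra.
by have := rnormBl y x; rewrite rnormB_sym; lra.
Qed.

Lemma compact_circle : compact [set z : C^o | rnorm z = 1].
Proof.
by apply: subclosed_compact closed_circle compact_disc _ => z /= ->.
Qed.

Lemma compact_unimodular (S : eqType) :
  @compact (prod_topology (fun=> C^o)) [set z : S -> C | forall s, rnorm (z s) = 1].
Proof.
exact: (@tychonoff S (fun=> C^o) (fun=> [set z | rnorm z = 1])
  (fun=> compact_circle)).
Qed.

Lemma nbhs_coordinate (S : eqType) (z : prod_topology (fun _ : S => C^o)) s (e : R) :
  0 < e -> nbhs z [set w | rnorm (z s - w s) < e].
Proof.
move=> e0; apply: (@proj_continuous S (fun=> C^o) s z [set c | rnorm (z s - c) < e]).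
by apply/nbhs_rnormP; exists e.
Qed.

(** With the circle as [D] this gives the set that [T] approaches under the spectral decomposition;
    with the disc it gives finite nets of convex hulls. *)
Lemma compact_span (X : normedModType C) (I : finType) (Q : I -> X) (D : set C^o) :
  compact D -> compact [set \sum_k z k *: Q k | z in [set z : I -> C | forall k, D (z k)]].
Proof.
move=> cD.
pose f (z : prod_topology (fun _ : I => C^o)) : X := \sum_k z k *: Q k.
have cf : continuous f.
  move=> z; apply: (cvg_rnormP (fmap_filter f (nbhs_filter z)) (f z)).2 => e e0.
  pose K := 1 + \sum_k rnorm (Q k).
  have K0 : 0 < K by rewrite ltr_pwDl// sumr_ge0// => k _; exact: rnorm_ge0.
  have Fz : nbhs z [set w : prod_topology (fun _ : I => C^o) |
      forall k, rnorm (z k - w k) < e / K].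
    apply: (@filter_forall _ I (fun k => [set w | rnorm (z k - w k) < e / K])
      (nbhs z) (nbhs_filter z)) => k.
    exact: (nbhs_coordinate z k (divr_gt0 e0 K0)).
  apply: filterS Fz => w /= zw; rewrite /f -sumrB.
  apply: (@le_lt_trans _ _ (e / K * \sum_k rnorm (Q k))); last first.
    by rewrite mulrAC ltr_pdivrMr// ltr_pM2l// ltrDr.
  apply: (le_trans (rnorm_sum _ _ _)); rewrite mulr_sumr ler_sum// => k _.
  by rewrite -scalerBl rnormZ ler_wpM2r ?rnorm_ge0// ltW.
apply: (@continuous_compact _ _ f); first exact: continuous_subspaceT.
exact: (@tychonoff I (fun=> C^o) (fun=> D) (fun=> cD)).
Qed.

(** The sets [A i] generate a filter on the compact product of circles. A neighbourhood of its
    cluster point controls finitely many coordinates, hence the list [l]. *)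
Lemma unimodular_cluster (S : choiceType) (I : Type) (D : set I) (A : I -> set (S -> C)) :
  (exists i, D i) ->
  (forall i j, D i -> D j -> exists2 k, D k & A k `<=` A i `&` A j) ->
  (forall i, D i -> exists2 z, A i z & forall s, rnorm (z s) = 1) ->
  exists2 z : S -> C, forall s, rnorm (z s) = 1 &
    forall i (l : seq S) e, D i -> 0 < e ->
      exists2 w, A i w & forall s, s \in l -> rnorm (z s - w s) < e.
Proof.
move=> [i0 Di0] AI A0.
pose U := [set z : S -> C^o | forall s, rnorm (z s) = 1].
pose F := filter_from D (fun i => A i `&` U : set (S -> C^o)).
have FF : ProperFilter F.
  apply: filter_from_proper => [|i Di]; last first.
    by have [z Az z1] := A0 i Di; exists z.
  apply: filter_from_filter; first by exists i0.
  move=> i j Di Dj; have [k Dk kij] := AI i j Di Dj; exists k => //.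
  by move=> z [/kij[Ai Aj] Uz].
have [|z [Uz Fz]] := @compact_unimodular S F FF.
  by exists i0 => // z [].
exists z => // i l e Di e0.
have [||w [[Aw _] wl]] := Fz (A i `&` U) [set w | forall s, s \in l -> rnorm (z s - w s) < e].
- by exists i.
- elim: l => [|s l ih]; first by apply: filterS filterT => w _.
  have := @nbhs_coordinate S z s e e0.
  apply: filterS2 ih => w wl ws t; rewrite inE => /orP[/eqP ->//|]; exact: wl.
- by exists w.
Qed.

End ComplexCompact.

(** * Unitary spectrum and poles *)

Section Spectrum.
Context {R : realType} {S : nmodType}.
Local Notation C := R[i].
Variable X : normedModType C.
Variable T : S -> bop X.
Hypothesis Trep : representation T.
Variable M : R.
Hypothesis TM : forall s, rnorm (T s) <= M.

(** On a vector [x] that is approximately eigen at [s], [t] and [s + t], the defect of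
    multiplicativity is a combination of three errors. One of them passes through [T s], so their
    total weight is [M + 2]. *)
Lemma approx_eigen_unitary (z : S -> C) : (forall s, rnorm (z s) = 1) ->
  approx_eigen T z -> unitary_character z.
Proof.
move=> z1 Tz; have M0 := rep_bound_ge0 TM.
have M2 : 0 < M + 2 by rewrite ltr_wpDl.
split=> [s|s t|]; first exact/unimodularE.
  apply/eqP; rewrite -subr_eq0; apply/eqP/rnorm_small0 => e e0.
  have d0 : 0 < e / (M + 2) by rewrite divr_gt0.
  have [x x0 xz] := Tz [:: s; t; s + t] _ d0.
  have x1 : 0 < rnorm x by rewrite rnorm_gt0.
  have hs := xz s; have ht := xz t; have hst := xz (s + t).
  rewrite !inE eqxx /= in hs; rewrite !inE eqxx orbT /= in ht.
  rewrite !inE eqxx !orbT /= in hst.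
  rewrite -(ler_pM2r x1) -rnormZ.
  have -> : (z (s + t) - z s * z t) *: x = T s (T t x - z t *: x)
      + z t *: (T s x - z s *: x) - (T (s + t) x - z (s + t) *: x).
    rewrite Trep.1 bop_mulE (linearB (T s)) (linearZ_LR (T s)) scalerBr !scalerA subrKA.
    by rewrite opprB [RHS]addrC subrKA scalerBl (mulrC (z s)).
  have := rnormB (T s (T t x - z t *: x) + z t *: (T s x - z s *: x))
    (T (s + t) x - z (s + t) *: x).
  have := rnormD (T s (T t x - z t *: x)) (z t *: (T s x - z s *: x)).
  have := rnorm_bop (T s) (T t x - z t *: x); rewrite rnormZ z1 mul1r.
  have : rnorm (T s) * rnorm (T t x - z t *: x) <= M * (e / (M + 2) * rnorm x).
    by rewrite ler_pM ?rnorm_ge0// ht.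
  have -> : M * (e / (M + 2) * rnorm x) = e * rnorm x - 2 * (e / (M + 2) * rnorm x).
    by field; rewrite gt_eqF.
  have := hs isT; have := hst isT; lra.
apply/eqP; rewrite -subr_eq0; apply/eqP/rnorm_small0 => e e0.
have [x x0 xz] := Tz [:: 0] _ e0; have := xz _ (mem_head _ _).
rewrite Trep.2 bop_oneE -[X in rnorm (X - _)]scale1r -scalerBl rnormZ rnormB_sym.
by rewrite ler_pM2r// rnorm_gt0.
Qed.

(* If no [T s] is a strict contraction, the approximate joint eigenvectors found for
   finite subsets of [S] cluster, by compactness of the torus, at a character. *)
Lemma cvg0_approx_eigen :
  (forall z, unitary_character z -> ~ approx_eigen T z) ->
  T s @[s --> eventually_in (sdir S)] --> (0 : bop X).
Proof.
move=> noz; have [//|T1] := cvg0_or_norm_ge1 Trep TM; exfalso.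
pose A (i : seq S * R) : set (S -> C) := [set z | exists2 x, x != 0 &
  forall s, s \in i.1 -> rnorm (T s x - z s *: x) <= i.2 * rnorm x].
have [|[l e] [m d] /= e0 d0|[l e] /= e0|z z1 Az] :=
    @unimodular_cluster R S _ [set i : seq S * R | 0 < i.2] A.
- by exists ([::], 1); exact: ltr01.
- exists (l ++ m, Num.min e d) => /=; first by rewrite lt_min e0.
  move=> z [x x0 xz]; split; exists x => //= s sl.
    apply: le_trans (xz s _) _; first by rewrite mem_cat sl.
    by rewrite ler_wpM2r ?rnorm_ge0// ge_min lexx.
  apply: le_trans (xz s _) _; first by rewrite mem_cat sl orbT.
  by rewrite ler_wpM2r ?rnorm_ge0// ge_min lexx orbT.
- by have [z z1 Az] := joint_approx_vector Trep TM l T1 e0; exists z.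
have Tz : approx_eigen T z.
  move=> l e e0; have e2 : 0 < e / 2 by rewrite divr_gt0.
  have [w [x x0 xw] wl] := Az (l, e / 2) l (e / 2) e2 e2.
  exists x => // s sl; have /= := xw s sl; have /ltW := wl s sl.
  move=> /(ler_wpM2r (rnorm_ge0 x)); rewrite -rnormZ scalerBl rnormB_sym.
  have := rnorm_dist (T s x) (w s *: x) (z s *: x); lra.
exact: noz (approx_eigen_unitary z1 Tz) Tz.
Qed.

(** The operators that become small on ever better approximate eigenvectors form a left ideal [J].
    It contains the generators, but not 1. *)
Lemma approx_eigen_sigma z : unitary_character z -> approx_eigen T z -> sigma_uni T z.
Proof.
move=> uz Tz; split => // idT.
pose J := [set B : bop X | forall e : R, 0 < e -> exists (l : seq S) (d : R), 0 < d /\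
  forall x, (forall s, s \in l -> rnorm (T s x - z s *: x) <= d * rnorm x) ->
    rnorm (B x) <= e * rnorm x].
have J1 : J 1.
  have : [set: bop X] 1 by [].
  rewrite -idT; apply: smallest_sub; last first.
    move=> _ [s _ <-] e e0; exists [:: s], e; split => // x xs.
    by rewrite bop_subE bop_scaleE bop_oneE rnormB_sym xs ?mem_head.
  split.
  - move=> e e0; exists [::], 1; split => // x _.
    by rewrite rnorm0 mulr_ge0 ?rnorm_ge0 ?ltW.
  - move=> A B JA JB e e0; have e2 : 0 < e / 2 by rewrite divr_gt0.
    have [[l [d [d0 Al]]] [m [c [c0 Bm]]]] := (JA _ e2, JB _ e2).
    exists (l ++ m), (Num.min d c); split => [|x xz]; first by rewrite lt_min d0.
    rewrite bop_addE; apply: (le_trans (rnormD _ _)); rewrite [e]splitr mulrDl.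
    rewrite lerD ?Al ?Bm// => s sl; apply: le_trans (xz s _) _; rewrite ?mem_cat ?sl ?orbT//.
      by rewrite ler_wpM2r ?rnorm_ge0// ge_min lexx.
    by rewrite ler_wpM2r ?rnorm_ge0// ge_min lexx orbT.
  - move=> A B JB e e0.
    have A1 : 0 < rnorm A + 1 by rewrite ltr_wpDl ?rnorm_ge0.
    have [l [d [d0 Bl]]] := JB _ (divr_gt0 e0 A1); exists l, d; split => // x xz.
    rewrite bop_mulE; apply: (le_trans (rnorm_bop _ _)).
    apply: (@le_trans _ _ ((rnorm A + 1) * (e / (rnorm A + 1) * rnorm x))).
      by rewrite ler_pM ?rnorm_ge0 ?lerDl ?Bl.
    by rewrite mulrA mulrC [(rnorm A + 1) * _]mulrC divfK ?gt_eqF// mulrC.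
have [|l [d [d0 lx]]] := J1 (1 / 2); first by rewrite divr_gt0.
have [x x0 xz] := Tz l d d0; have := lx x xz; rewrite bop_oneE.
have : 0 < rnorm x by rewrite rnorm_gt0.
lra.
Qed.

End Spectrum.

(** * Spectral gaps at poles and finiteness of the set of eigencharacters *)

Section Poles.
Context {R : realType} {S : nmodType}.
Local Notation C := R[i].
Variable E : normedModType C.
Variable T : S -> bop E.
Hypothesis Trep : representation T.
Variable M : R.
Hypothesis TM : forall s, rnorm (T s) <= M.

Lemma restr_rep_representation (F : closed_subspace E) (TF : rep_invariant T F) :
  representation (restr_rep TF).
Proof.
split=> [s t|]; apply: bop_eqP => x; apply: val_inj => /=; first by rewrite Trep.1.
by rewrite Trep.2.
Qed.

Lemma rnorm_restr (F : closed_subspace E) (f : bop E) (fF : forall x, csub F x -> csub F (f x)) :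
  rnorm (restr fF) <= rnorm f.
Proof. by apply: rnorm_bop_lub => [|x]; [exact: rnorm_ge0|exact: (rnorm_bop f (subsp_val x))]. Qed.

(** [approx_eigen_sigma] on [ker P], read backwards: the spectral condition on the restricted
    representation becomes a condition on vectors of [E]. *)
Lemma pole_gap z : pole T z -> exists P : bop E,
  [/\ P * P = P, range P = ker_char z T, forall s, P * T s = T s * P &
    exists (l : seq S) (e : R), 0 < e /\ forall x, P x = 0 ->
      (forall s, s \in l -> rnorm (T s x - z s *: x) <= e * rnorm x) -> x = 0].
Proof.
move=> [uz [P [PP rP [PT nsig]]]]; exists P; split => //.
apply/not_existsP => H; apply: nsig; apply: approx_eigen_sigma => //.
move=> l e e0; apply/not_exists2P => noy; apply: (H l).
exists e; split => // x Px xz; apply/eqP/negPn/negP => x0.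
have [] := noy (@Subsp _ _ (ker_op P) x (asboolT Px)).
- by apply; apply: contra_neq x0 => /(congr1 (@subsp_val _ _ _)).
- by apply => s sl; exact: xz.
Qed.

(** By commutation [P x] is an eigenvector for [w] as well as for [z], and these differ at some
    [s]. *)
Lemma eigen_proj0 (P : bop E) (z w : S -> C) x : range P = ker_char z T ->
  (forall s, P * T s = T s * P) -> w <> z -> ker_char w T x -> P x = 0.
Proof.
move=> rP PT wz wx; have [s zws] : exists s, z s != w s.
  apply: contrapT => H; apply: wz; apply/funext => s.
  by apply/eqP; apply: contrapT => /negP; rewrite eq_sym => zw; apply: H; exists s.
have Pker : ker_char z T (P x) by rewrite -rP; exists x.
have := congr1 (fun f : bop E => f x) (PT s); rewrite !bop_mulE.
rewrite wx (linearZ_LR P) Pker => /eqP; rewrite eq_sym -subr_eq0 -scalerBl scaler_eq0.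
by rewrite subr_eq0 (negPf zws) => /eqP.
Qed.

(* Eigenvectors of characters [w != z] near [z] lie in [ker P] and contradict the gap. *)
Lemma eigen_character_finite : sigma_uni T `<=` [set z | pole T z] ->
  finite_set [set z | unitary_character z /\ exists2 x, x != 0 & ker_char z T x].
Proof.
move=> Tf; set D := [set z | _]; apply: contrapT => Dinf.
(* The index is a finite list of characters to avoid. As [D] is infinite something is always left,
   so the cluster point [z] is an accumulation point of [D]. *)
have [|i j _ _|i _|z z1 Az] := @unimodular_cluster R S (seq (S -> C)) setT
    (fun i => D `\` [set` i]).
- by exists [::].
- exists (i ++ j) => // w [Dw /= wij]; split; split => //= wi; apply: wij;
    by rewrite /= mem_cat wi ?orbT.
- apply/not_exists2P => H; apply: Dinf.
  apply: (@sub_finite_set _ _ [set` i]); last exact: finite_seq.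
  move=> w Dw; have [Hw|[]] := H w.
    by apply: contrapT => wi; apply: Hw.
  by move=> s; apply/unimodularE; case: Dw => -[].
have eig w x s : ker_char w T x -> rnorm (T s x - z s *: x) = rnorm (z s - w s) * rnorm x.
  by move=> wx; rewrite wx -scalerBl rnormZ rnormB_sym.
have Tz : approx_eigen T z.
  move=> l e e0; have [w [[_ [x x0 wx]] _] wl] := Az [::] l e I e0.
  by exists x => // s sl; rewrite (eig w)// ler_wpM2r ?rnorm_ge0// ltW// wl.
have [P [PP rP PT [l [e [e0 gap]]]]] := pole_gap (Tf _
  (approx_eigen_sigma (approx_eigen_unitary Trep TM z1 Tz) Tz)).
have [w [[_ [x x0 wx]] wz] wl] := Az [:: z] l e I e0.
move/eqP: x0; apply; apply: (gap x); last first.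
  by move=> s sl; rewrite (eig w)// ler_wpM2r ?rnorm_ge0// ltW// wl.
apply: eigen_proj0 rP PT _ wx => zw; apply: wz.
by rewrite /= inE; apply/eqP.
Qed.

End Poles.

(** * The spectral decomposition obtained from poles *)

Section PolesDecomposition.
Context {R : realType} {S : nmodType}.
Local Notation C := R[i].
Variable E : normedModType C.
Variable T : S -> bop E.
Hypothesis Trep : representation T.
Variable M : R.
Hypothesis TM : forall s, rnorm (T s) <= M.

(** The sum [Q] of the pole projections over all eigencharacters splits [E]. On [ker Q] an
    approximate eigencharacter would be a pole of [T], and the gap at that pole excludes it, so
    [cvg0_approx_eigen] applies. *)
Lemma poles_decomposition : sigma_uni T `<=` [set z | pole T z] ->
  exists Er Es : closed_subspace E,
    [/\ is_direct_sum [set: E] (fun b : bool => if b then csub Er else csub Es),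
        rep_invariant T Er,
        exists (n : nat) (chi : 'I_n -> S -> R[i]),
          (forall k, unitary_character (chi k)) /\
          is_direct_sum Er (fun k => ker_char (chi k) T) &
        exists TEs : rep_invariant T Es,
          restr_rep TEs s @[s --> eventually_in (sdir S)] -->
            (0 : bop (subsp Es))].
Proof.
move=> Tf; have /finite_seqP[l0 Dl0] := eigen_character_finite Trep TM Tf.
(* Without repetitions [chi] is injective, so each [P k] vanishes on the eigenspaces of the other
   indices. *)
pose l := undup l0; pose n := size l; pose chi (k : 'I_n) := tnth (in_tuple l) k.
have chi_inj : injective chi.
  by apply/tuple_uniqP; exact: undup_uniq.
have chiD k : [set z | unitary_character z /\ exists2 x, x != 0 & ker_char z T x] (chi k).
  by rewrite Dl0 /= -mem_undup; exact: mem_tnth.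
have Dchi z x : unitary_character z -> x != 0 -> ker_char z T x -> exists k, z = chi k.
  move=> uz x0 zx; have : [set` l0] z by rewrite -Dl0; split => //; exists x.
  rewrite /= -mem_undup -/l -[l in _ \in l]/(tval (in_tuple l)) => /tnthP[k zk].
  by exists k.
have /choice[P HP] : forall k, exists P : bop E,
    [/\ P * P = P, range P = ker_char (chi k) T, forall s, P * T s = T s * P &
    exists (l : seq S) (e : R), 0 < e /\ forall x, P x = 0 ->
      (forall s, s \in l -> rnorm (T s x - chi k s *: x) <= e * rnorm x) -> x = 0].
  move=> k; have [uk [x x0 xk]] := chiD k; apply: (@pole_gap _ _ _ T); apply: Tf.
  apply: approx_eigen_sigma => // m e e0; exists x => // s _.
  by rewrite xk subrr rnorm0 mulr_ge0 ?rnorm_ge0 ?ltW.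
have Pker k x : ker_char (chi k) T (P k x) by have [_ <- _ _] := HP k; exists x.
have PE k x : ker_char (chi k) T x -> P k x = x.
  have [PP <- _ _] := HP k; move=> [y _ <-].
  by rewrite -[in LHS]bop_mulE PP.
have P0 k j x : k != j -> ker_char (chi j) T x -> P k x = 0.
  have [_ rP PT _] := HP k => kj; apply: (eigen_proj0 rP PT).
  by move=> /chi_inj jk; rewrite jk eqxx in kj.
pose Q := \sum_k P k.
have QE x : Q x = \sum_k P k x by exact: bop_sumE.
have PQ k x : P k (Q x) = P k x.
  rewrite QE bop_sum (bigD1 k)//= PE// big1 ?addr0// => j jk.
  by apply: (P0 k j); rewrite 1?eq_sym.
have QQ x : Q (Q x) = Q x by rewrite QE; under eq_bigr do rewrite PQ; rewrite -QE.
have QT s : Q * T s = T s * Q.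
  by rewrite mulr_suml mulr_sumr; apply: eq_bigr => k _; have [] := HP k.
have Qsum v : (forall k, ker_char (chi k) T (v k)) -> forall k, P k (\sum_k v k) = v k.
  move=> vk k; rewrite bop_sum (bigD1 k)//= PE// big1 ?addr0// => j jk.
  by apply: (P0 k j); rewrite 1?eq_sym.
(* The range of [Q] is presented as a kernel, which makes its closedness immediate. *)
have Er_eq x : csub (ker_op (1 - Q)) x <-> Q x = x.
  split => [/eqP|xQ]; first by rewrite bop_subE subr_eq0 => /eqP <-.
  by change ((1 - Q) x = 0); rewrite bop_subE xQ subrr.
have Q1T s : (1 - Q) * T s = T s * (1 - Q) by rewrite mulrBl mulrBr QT mul1r mulr1.
exists (ker_op (1 - Q)), (ker_op Q); split.
- split.
    apply/seteqP; split => // x _ /=.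
    exists (fun b => if b then Q x else x - Q x).
      case; first by apply/Er_eq.
      change (Q (x - Q x) = 0).
      by rewrite bopB QQ subrr.
    by rewrite big_bool /= addrC subrK.
  move=> v Hv; rewrite big_bool /= => v0.
  have vt : Q (v true) = v true by apply/Er_eq; exact: (Hv true).
  have vf : Q (v false) = 0 := Hv false.
  have vt0 : v true = 0.
    by have := congr1 Q v0; rewrite bopD vt vf addr0 bop0.
  by case => //; move: v0; rewrite vt0 add0r.
- exact: ker_invariant.
- exists n, chi; split; first by move=> k; have [] := chiD k.
  split.
    apply/seteqP; split => x.
      by move=> /Er_eq xQ; exists (fun k => P k x); rewrite // -QE.
    move=> [v vk <-]; apply/Er_eq; rewrite QE.
    by apply: eq_bigr => k _; exact: Qsum.
  by move=> v vk v0 k; rewrite -(Qsum v vk k) v0 bop0.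
- exists (ker_invariant QT).
  apply: (@cvg0_approx_eigen R S _ _ _ M) => [|s|z uz Tz].
  + exact: restr_rep_representation.
  + exact: le_trans (rnorm_restr _) (TM s).
  have gap (P' : bop E) : (forall x, Q x = 0 -> P' x = 0) ->
    (exists (l : seq S) (e : R), 0 < e /\ forall x : E, P' x = 0 ->
      (forall s, s \in l -> rnorm (T s x - z s *: x) <= e * rnorm x) -> x = 0) -> False.
    move=> P'Q [m [e [e0 He]]]; have [x x0 xz] := Tz m e e0.
    move/eqP: x0; apply; apply: val_inj; apply: (He (subsp_val x)) => //.
    exact/P'Q/(subspP x).
  have [P' [_ rP' _ gP']] : exists P : bop E,
     [/\ P * P = P, range P = ker_char z T, forall s, P * T s = T s * P &
      exists (l : seq S) (e : R), 0 < e /\ forall x, P x = 0 ->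
      (forall s, s \in l -> rnorm (T s x - z s *: x) <= e * rnorm x) -> x = 0].
    apply: (@pole_gap _ _ _ T); apply: Tf; apply: approx_eigen_sigma => // m e e0.
    have [x x0 xz] := Tz m e e0; exists (subsp_val x) => //.
  (* If [z] is some [chi k], the gap of [P k] applies, since [P k] vanishes on [ker Q]. Otherwise
     [z] has no eigenvector, so [P'] is zero and its gap holds on all of [E]. *)
  have [[k zk]|nz] := pselect (exists k, z = chi k).
    have [_ _ _] := HP k; rewrite -zk; apply: gap => x Qx.
    by rewrite -PQ Qx bop0.
  apply: (gap P' _ gP') => x _; apply/eqP; apply: contrapT => /negP Px0.
  apply: nz; apply: (Dchi _ (P' x)) => //.
  by rewrite -rP'; exists x.
Qed.
End PolesDecomposition.

(** * From the decomposition to asymptotic compactness *)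

Section SetDist.
Context {R : realType}.
Variable X : normedModType R[i].
Implicit Types (x y : X) (A : set X).

Lemma set_dist_le x A y : A y -> set_dist x A <= rnorm (x - y).
Proof.
move=> Ay; apply: inf_lbound; last by exists y.
by exists 0 => _ [u _ <-]; exact: rnorm_ge0.
Qed.

Lemma set_dist_ge0 x A : 0 <= set_dist x A.
Proof.
(* For empty [A] the infimum has the default value 0. *)
have [->|/set0P[y Ay]] := eqVneq A set0; first by rewrite /set_dist image_set0 inf0.
apply: lb_le_inf; first by exists (rnorm (x - y)), y.
by move=> _ [u _ <-]; exact: rnorm_ge0.
Qed.

Lemma set_dist_lt x A (e : R) : A !=set0 -> set_dist x A < e ->
  exists2 y, A y & rnorm (x - y) < e.
Proof.
move=> [y0 Ay0] xe.
have hi : has_inf [set complex.Re `|x - y| | y in A].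
  split; first by exists (rnorm (x - y0)), y0.
  by exists 0 => _ [u _ <-]; exact: rnorm_ge0.
have d0 : 0 < e - set_dist x A by rewrite subr_gt0.
have [_ [y Ay <-] yd] := inf_adherent d0 hi; exists y => //.
by move: yd; rewrite -/(set_dist x A) -/(rnorm _); lra.
Qed.

Lemma set_dist_cvg0 (D : directedType) (x : D -> X) A :
  A !=set0 ->
  (set_dist (x i) A @[i --> eventually_in D] --> (0 : R)) <->
  (forall e : R, 0 < e -> \forall i \near eventually_in D,
    exists2 y, A y & rnorm (x i - y) < e).
Proof.
move=> A0; split => [/cvgrPdist_lt H e e0|H].
  apply: filterS (H e e0) => i; rewrite sub0r normrN ger0_norm ?set_dist_ge0//.
  exact: set_dist_lt.
apply/cvgrPdist_lt => e e0; apply: filterS (H e e0) => i [y Ay xy].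
rewrite sub0r normrN ger0_norm ?set_dist_ge0//.
exact: le_lt_trans (set_dist_le _ Ay) xy.
Qed.

End SetDist.

Section Decomposition.
Context {R : realType} {S : nmodType}.
Local Notation C := R[i].
Variable E : normedModType C.
Variable T : S -> bop E.
Hypothesis Trep : representation T.
Variable M : R.
Hypothesis TM : forall s, rnorm (T s) <= M.

(** Lagrange interpolation: [B] is a product of factors [(T s - w s) / (z s - w s)], one for each
    entry [w <> z] of [l], with [s] chosen for that [w]. *)
Lemma eigen_separate (z : S -> C) (l : seq (S -> C)) : exists B : bop E,
  (forall x, ker_char z T x -> B x = x) /\
  (forall w, w \in l -> w <> z -> forall x, ker_char w T x -> B x = 0).
Proof.
elim: l => [|w l [B [Bz Bl]]]; first by exists 1.
have [wz|wz] := pselect (w = z).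
  exists B; split => // v; rewrite inE => /orP[/eqP ->//|]; exact: Bl.
have [s zws] : exists s, z s - w s != 0.
  apply: contrapT => H; apply: wz; apply/funext => s.
  by apply/esym/eqP; rewrite -subr_eq0; apply: contrapT => /negP zw; apply: H; exists s.
pose F : bop E := (z s - w s)^-1 *: (T s - w s *: (1 : bop E)).
have FE v x : ker_char v T x -> F x = ((z s - w s)^-1 * (v s - w s)) *: x.
  by move=> vx; rewrite bop_scaleE bop_subE bop_scaleE vx -scalerBl scalerA.
exists (B * F); split => [x zx|v vl vz x vx]; rewrite bop_mulE.
  by rewrite (FE z)// mulVf// scale1r Bz.
rewrite (FE v)// bopZ; move: vl; rewrite inE => /orP[/eqP ->|vl].
  by rewrite subrr mulr0 scale0r.
by rewrite (Bl v)// scaler0.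
Qed.

(* The component [q x k] of [x] in [ker (chi_k - T)] is the limit of
   [(chi k t)^-1 *: B (T t x)], with [B] as in [eigen_separate]; this bounds the spectral
   projections without the open mapping theorem. *)
Lemma decomposition_dist0 (Er Es : closed_subspace E) n (chi : 'I_n -> S -> R[i])
    (TEs : rep_invariant T Es) :
  is_direct_sum [set: E] (fun b : bool => if b then csub Er else csub Es) ->
  (forall k, unitary_character (chi k)) ->
  is_direct_sum Er (fun k => ker_char (chi k) T) ->
  restr_rep TEs s @[s --> eventually_in (sdir S)] --> (0 : bop (subsp Es)) ->
  exists A : set (bop E), [/\ A !=set0, compact (closure A) &
    set_dist (T s) A @[s --> eventually_in (sdir S)] --> (0 : R)].
Proof.
move=> [ET Eind] uchi [Er_eq rind] Tcvg.
have Tsmall (e : R) : 0 < e -> exists t0, forall t, sle t0 t -> forall x, csub Es x ->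
    rnorm (T t x) <= e * rnorm x.
  move=> e0; have /cvg_rnormP/(_ e e0)[t0 _ Ht] := Tcvg.
  exists t0 => t tt0 x xE; have := Ht t tt0; rewrite /= sub0r rnormN => He.
  have := rnorm_bop (restr_rep TEs t) (Subsp (asboolT xE)).
  by move=> /le_trans; apply; rewrite ler_wpM2r ?rnorm_ge0// ltW.
have dec x : exists u : 'I_n -> E,
    (forall k, ker_char (chi k) T (u k)) /\ csub Es (x - \sum_k u k).
  have : [set: E] x by []. rewrite ET => -[v vb xv].
  have : csub Er (v true) by exact: (vb true).
  rewrite Er_eq => -[u uk uv]; exists u; split => //.
  by rewrite -xv big_bool /= uv addrC addrK; exact: (vb false).
have kerP k (a : C) x y : ker_char (chi k) T x -> ker_char (chi k) T y ->
    ker_char (chi k) T (a *: x + y).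
  by move=> kx ky s; rewrite bopD bopZ kx ky scalerDr !scalerA mulrC.
have uniq0 (u : 'I_n -> E) : (forall k, ker_char (chi k) T (u k)) ->
    csub Es (\sum_k u k) -> forall k, u k = 0.
  move=> uk uE; apply: rind => //.
  (* The sum, taken in [Er], and its negative, taken in [Es], decompose 0. *)
  have := Eind (fun b : bool => if b then \sum_k u k else - \sum_k u k).
  move=> /(_ _ _ true); apply; last by rewrite big_bool /= subrr.
  case; first by rewrite Er_eq; exists u.
  by rewrite -[X in csub _ X]addr0 -scaleN1r; apply: csubP => //; exact: csub0.
have [q Hq] := choice dec.
have ql k : linear (q ^~ k).
  move=> a x y; pose u j := a *: q x j + q y j - q (a *: x + y) j.
  have -> // : q (a *: x + y) k = a *: q x k + q y k.
  apply/esym/eqP; rewrite -subr_eq0; apply/eqP; apply: (uniq0 u) => [j|].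
    rewrite /u addrC -scaleN1r; apply: (kerP); first by have [] := Hq (a *: x + y).
    by apply: (kerP); [have [] := Hq x|have [] := Hq y].
  have -> : \sum_k u k = (-1) *: (a *: (x - \sum_k q x k) + (y - \sum_k q y k))
      + (a *: x + y - \sum_k q (a *: x + y) k).
    rewrite /u sumrB big_split /= -scaler_sumr scaleN1r scalerBr (addrACA (a *: x)).
    by rewrite -opprD opprB subrKA.
  have [_ hx] := Hq x; have [_ hy] := Hq y; have [_ hxy] := Hq (a *: x + y).
  by do 2! apply: csubP => //.
(* The list [chi] may repeat a character; directness of the sum then forces the repeated eigenspace
   to be zero. *)
have dup j k x : j != k -> chi j = chi k -> ker_char (chi j) T x -> x = 0.
  move=> jk ejk xj; pose u i := if i == j then x else if i == k then - x else 0.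
  have -> : x = u j by rewrite /u eqxx.
  apply: rind => [i|].
    rewrite /u; case: eqP => [->//|_]; case: eqP => [->|_] s.
      by rewrite -scaleN1r bopZ -ejk xj !scalerA mulrC.
    by rewrite bop0 scaler0.
  rewrite (bigD1 j)//= (bigD1 k)/= 1?eq_sym// /u eqxx eq_sym (negPf jk) eqxx addrA subrr add0r.
  by rewrite big1// => i /andP[/negPf -> /negPf ->].
have qb k : exists K : R, forall x, rnorm (q x k) <= K * rnorm x.
  have [B [Bk B0]] := eigen_separate (chi k) (codom chi).
  exists (rnorm B * M) => x; apply/ler_addgt0Pr => e e0.
  have [qx wE] := Hq x; set w := x - _ in wE.
  have K0 : 0 < rnorm B * rnorm w + 1 by rewrite ltr_wpDl// mulr_ge0 ?rnorm_ge0.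
  have [t Ht] := Tsmall _ (divr_gt0 e0 K0).
  have {}Ht := Ht t (sle_refl t) w wE.
  have qj j : j != k -> B (q x j) = 0.
    move=> jk; have [ejk|ejk] := pselect (chi j = chi k); last first.
      by apply: (B0 (chi j)) => //; exact: codom_f.
    by rewrite (dup _ _ _ jk ejk (qx j)) bop0.
  have Btx : B (T t x) = chi k t *: q x k + B (T t w).
    have {1}-> : x = \sum_k q x k + w by rewrite /w addrC subrK.
    rewrite !bopD !bop_sum (bigD1 k)//= big1 ?addr0 => [|j jk].
      by rewrite qx bopZ Bk.
    by rewrite qx bopZ qj// scaler0.
  have -> : rnorm (q x k) = rnorm (B (T t x) - B (T t w)).
    by rewrite Btx addrK rnormZ (unimodularE _).1 ?mul1r//; have [] := uchi k.
  apply: (le_trans (rnormB _ _)); apply: lerD.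
    apply: (le_trans (rnorm_bop _ _)); rewrite -mulrA ler_wpM2l ?rnorm_ge0//.
    by apply: (le_trans (rnorm_bop _ _)); rewrite ler_wpM2r ?rnorm_ge0.
  apply: (le_trans (rnorm_bop _ _)).
  apply: (le_trans (ler_wpM2l (rnorm_ge0 _) Ht)).
  rewrite mulrCA -mulrA ler_piMr ?(ltW e0)// mulrC ler_pdivrMr//.
  by rewrite mul1r lerDl.
have /choice[Q HQ] : forall k, exists Qk : bop E, forall x, Qk x = q x k.
  by move=> k; have [K HK] := qb k; exact: exists_bop (ql k) HK.
pose U := [set z : 'I_n -> C | forall k, rnorm (z k) = 1].
pose f (z : 'I_n -> C) : bop E := \sum_k z k *: Q k.
have cA : compact (f @` U) by exact: (@compact_span R (bop E) 'I_n Q _ compact_circle).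
have A0 : f @` U !=set0 by exists (f (fun=> 1)), (fun=> 1) => // k; exact: rnorm1.
exists (f @` U); split => //.
  have /closure_id <- // := compact_closed (@norm_hausdorff _ _) cA.
apply/set_dist_cvg0 => // e e0.
(* At [x] the operators [T t] and [f (chi^~ t)] differ by [T t w], where [w] is the component of [x]
   in [Es] and [rnorm w <= K * rnorm x]. *)
pose K := 1 + \sum_k rnorm (Q k).
have K0 : 0 < K by rewrite ltr_pwDl// sumr_ge0// => k _; exact: rnorm_ge0.
have e2 : 0 < e / 2 by rewrite divr_gt0.
have [t0 Ht] := Tsmall _ (divr_gt0 e2 K0).
exists t0 => // t tt0; exists (f (chi^~ t)).
  by exists (chi^~ t) => // k; apply/unimodularE; have [] := uchi k.
apply: (@le_lt_trans _ _ (e / 2)); last by lra.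
apply: rnorm_bop_lub => [|x]; first exact: ltW.
have [qx wE] := Hq x; set w := x - _ in wE.
have -> : (T t - f (chi^~ t)) x = T t w.
  rewrite bop_subE bopB bop_sum bop_sumE; congr (_ - _); apply: eq_bigr => k _.
  by rewrite bop_scaleE HQ qx.
apply: (le_trans (Ht t tt0 w wE)); rewrite mulrAC ler_pdivrMr// -(mulrA (e / 2)).
rewrite ler_wpM2l ?(ltW e2)//.
rewrite mulrC /K mulrDl mul1r; apply: (le_trans (rnormB _ _)); rewrite lerD2l.
apply: (le_trans (rnorm_sum _ _ _)); rewrite mulr_suml ler_sum// => k _.
by rewrite -HQ rnorm_bop.
Qed.
End Decomposition.

(** * Subnets and the semigroup at infinity *)

Section Subnets.
Context {R : realType}.
Variable X : normedModType R[i].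

Lemma subnet_comp (I J K : directedType) (phi : J -> I) (psi : K -> J) :
  is_subnet phi -> is_subnet psi -> is_subnet (phi \o psi).
Proof.
move=> sphi spsi i; have [j Hj] := sphi i; have [k Hk] := spsi j.
by exists k => k' /Hk /Hj.
Qed.

(** The subnet is indexed by the pairs [(j, e)] with [x j] within [e] of [L], ordered by growing [j]
    and shrinking [e]. *)
Lemma cluster_subnet (J : directedType) (x : J -> X) (L : X) :
  (forall j0 (e : R), 0 < e -> exists2 j, dle j0 j & rnorm (L - x j) < e) ->
  exists (K : directedType) (psi : K -> J), is_subnet psi /\
    x (psi k) @[k --> eventually_in K] --> L.
Proof.
move=> H.
pose K := {p : J * R | 0 < p.2 /\ rnorm (L - x p.1) < p.2}.
pose le (p q : K) := dle (sval p).1 (sval q).1 /\ (sval q).2 <= (sval p).2.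
have mk j0 (e : R) : 0 < e -> exists2 p : K, dle j0 (sval p).1 & (sval p).2 = e.
  move=> e0; have [j j0j jL] := H j0 e e0.
  by exists (exist _ (j, e) (conj e0 jL)).
have K0 : inhabited K.
  by case: (dir_inhabited J) => j; have [p _ _] := mk j 1 ltr01; exists.
have le_refl p : le p p by split => //; exact: dle_refl.
have le_tr p q r : le p q -> le q r -> le p r.
  move=> [pq pq2] [qr qr2]; split; first exact: dle_trans qr.
  exact: le_trans pq2.
have le_dir p q : exists r, le p r /\ le q r.
  have [k [pk qk]] := dle_directed (sval p).1 (sval q).1.
  have e0 : 0 < Num.min (sval p).2 (sval q).2.
    by case: (svalP p) => p0 _; case: (svalP q) => q0 _; rewrite lt_min p0.
  have [r kr re] := mk k _ e0; exists r; split; split; rewrite ?re ?ge_min ?lexx ?orbT//.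
    exact: dle_trans kr.
  exact: dle_trans kr.
exists (DirectedType K0 le_refl le_tr le_dir), (fun p => (sval p).1); split.
  move=> j; have [p jp _] := mk j 1 ltr01; exists p => q [pq _]; exact: dle_trans pq.
apply/cvg_rnormP => e e0; case: (dir_inhabited J) => j.
have [p _ pe] := mk j e e0; exists p => // q [_ qp] /=.
by case: (svalP q) => _ /lt_le_trans; apply; rewrite -pe.
Qed.

End Subnets.

Section Asymptotics.
Context {R : realType} {S : nmodType}.
Local Notation C := R[i].
Variable E : normedModType C.
Variable T : S -> bop E.
Hypothesis Trep : representation T.
Variable M : R.
Hypothesis TM : forall s, rnorm (T s) <= M.

Lemma semigroup_at_infinityP f : semigroup_at_infinity T f <->
  forall s0 (e : R), 0 < e -> exists2 s, sle s0 s & rnorm (f - T s) < e.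
Proof.
split => [Tf s0 e e0|H s0 _].
  by have /closure_rnormP/(_ e e0)[_ [s s0s <-] fs] := Tf s0 I; exists s.
by apply/closure_rnormP => e e0; have [s s0s fs] := H s0 e e0; exists (T s) => //; exists s.
Qed.

(** If [T v] is near [f], and [T u] is near [g] with [u] beyond [s0], then [T (v + u)] is near
    [f * g] and [v + u] is still beyond [s0]. *)
Lemma semigroup_at_infinity_ideal : semigroup_at_infinity T !=set0 ->
  semigroup_ideal (closure (range T)) (semigroup_at_infinity T).
Proof.
move=> Tn0; split => // [f /semigroup_at_infinityP Tf|f g cf /semigroup_at_infinityP Tg].
  apply/closure_rnormP => e e0; have [s _ fs] := Tf 0 e e0.
  by exists (T s) => //; exists s.
apply/semigroup_at_infinityP => s0 e e0.
have M0 := rep_bound_ge0 TM; have f0 := rnorm_ge0 f.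
have e1 : 0 < e / 2 / (rnorm f + 1) by rewrite !divr_gt0// ltr_wpDl.
have e2 : 0 < e / 2 / (M + 1) by rewrite !divr_gt0// ltr_wpDl.
have [u s0u gu] := Tg s0 _ e1.
have /closure_rnormP/(_ _ e2)[_ [v _ <-] fv] := cf.
exists (v + u); first by apply: sle_trans s0u _; exists v; rewrite addrC.
have -> : f * g - T (v + u) = f * (g - T u) + (f - T v) * T u.
  by rewrite Trep.1 mulrBr mulrBl subrKA.
apply: (le_lt_trans (rnormD _ _)); rewrite [e]splitr.
apply: ltr_leD.
  apply: le_lt_trans (rnorm_bopM _ _) _.
  apply: (@le_lt_trans _ _ ((rnorm f + 1) * rnorm (g - T u))).
    by rewrite ler_wpM2r ?rnorm_ge0// lerDl.
  by rewrite mulrC -ltr_pdivlMr// ltr_wpDl.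
apply: le_trans (rnorm_bopM _ _) _.
apply: (@le_trans _ _ (rnorm (f - T v) * (M + 1))).
  by rewrite ler_wpM2l ?rnorm_ge0//; apply: le_trans (TM u) _; rewrite lerDl.
by rewrite -ler_pdivlMr ?ltr_wpDl// ltW.
Qed.

(** Once some [T s0] is near an element [g] of the ideal, [T (s0 + r)] is near [T r * g], which lies
    in the ideal too. *)
Lemma compact_ideal_dist0 (I : set (bop E)) :
  semigroup_ideal (closure (range T)) I -> compact I ->
  exists A : set (bop E), [/\ A !=set0, compact (closure A) &
    set_dist (T s) A @[s --> eventually_in (sdir S)] --> (0 : R)].
Proof.
move=> [[g Ig] IT Imul] cI; exists I; split; first by exists g.
  have /closure_id <- // := compact_closed (@norm_hausdorff _ _) cI.
apply/set_dist_cvg0; first by exists g.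
move=> e e0; have M0 := rep_bound_ge0 TM.
have e1 : 0 < e / (M + 1) by rewrite divr_gt0// ltr_wpDl.
have /closure_rnormP/(_ _ e1)[_ [s0 _ <-] gs] := IT g Ig.
exists s0 => // _ [r <-]; exists (T r * g).
  by apply: Imul => //; apply: subset_closure; exists r.
rewrite addrC Trep.1 -mulrBr; apply: le_lt_trans (rnorm_bopM _ _) _.
apply: (@le_lt_trans _ _ ((M + 1) * rnorm (T s0 - g))).
  by rewrite ler_wpM2r ?rnorm_ge0//; apply: le_trans (TM r) _; rewrite lerDl.
by rewrite rnormB_sym mulrC -ltr_pdivlMr// ltr_wpDl.
Qed.

(** The points of [A] close to tails of the subnet generate a filter, and its cluster point is also
    a cluster point of the subnet. *)
Lemma dist0_subnet (A : set (bop E)) : A !=set0 -> compact (closure A) ->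
  set_dist (T s) A @[s --> eventually_in (sdir S)] --> (0 : R) ->
  forall (J : directedType) (phi : J -> sdir S), is_subnet phi ->
    exists (K : directedType) (psi : K -> J), is_subnet psi /\
      exists L : bop E, T (phi (psi k)) @[k --> eventually_in K] --> L.
Proof.
move=> A0 cA /(@set_dist_cvg0 R (bop E) (sdir S) T A A0) TA J phi sphi.
have near j0 (e : R) : 0 < e -> exists2 j, dle j0 j & exists2 a, A a & rnorm (T (phi j) - a) < e.
  move=> e0; have [s0 _ Hs] := TA e e0; have [j1 Hj] := sphi s0.
  have [j [j0j j1j]] := dle_directed j0 j1.
  by exists j => //; apply: (Hs (phi j)); exact: Hj.
pose G := filter_from [set p : J * R | 0 < p.2]
  (fun p => [set a | A a /\ exists2 j, dle p.1 j & rnorm (T (phi j) - a) < p.2]).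
have GG : ProperFilter G.
  apply: filter_from_proper => [|[j e] e0]; last first.
    by have [k jk [a Aa ka]] := near j e e0; exists a; split => //; exists k.
  apply: filter_from_filter.
    by case: (dir_inhabited J) => j; exists (j, 1); exact: ltr01.
  move=> [i d] [j e] /= d0 e0; have [k [ik jk]] := dle_directed i j.
  exists (k, Num.min d e) => /=; first by rewrite lt_min d0.
  move=> a [Aa [m km]]; rewrite lt_min => /andP[md me]; split; split => //.
    by exists m => //; exact: dle_trans km.
  by exists m => //; exact: dle_trans km.
have [|L [_ GL]] := cA G GG.
  case: (dir_inhabited J) => j; exists (j, 1); first exact: ltr01.
  by move=> a [Aa _]; exact: subset_closure.
have [j0 e e0|K [psi [spsi cpsi]]] := @cluster_subnet R _ J (T \o phi) L.
  have e2 : 0 < e / 2 by rewrite divr_gt0.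
  have /cluster_rnormP
    /(_ [set a | A a /\ exists2 j, dle j0 j & rnorm (T (phi j) - a) < e / 2]) := GL.
  move=> /(_ (e / 2)) [||a [_ [j j0j ja]] La] //; first by exists (j0, e / 2).
  exists j => //=; apply: le_lt_trans (rnorm_dist _ a _) _.
  by rewrite [e]splitr ltrD// rnormB_sym.
by exists K, psi; split => //; exists L.
Qed.

Lemma subnet_limit (J : directedType) (phi : J -> sdir S) (L : bop E) :
  is_subnet phi -> T (phi j) @[j --> eventually_in J] --> L ->
  semigroup_at_infinity T L.
Proof.
move=> sphi /cvg_rnormP TL; apply/semigroup_at_infinityP => s0 e e0.
have [j0 Hj] := sphi s0; have [j1 _ Lj] := TL e e0.
have [j [j0j j1j]] := dle_directed j0 j1.
by exists (phi j); [exact: Hj|exact: Lj].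
Qed.

Lemma subnets_compact_at_infinity :
  (forall (J : directedType) (phi : J -> sdir S), is_subnet phi ->
    exists (K : directedType) (psi : K -> J), is_subnet psi /\
      exists L : bop E, T (phi (psi k)) @[k --> eventually_in K] --> L) ->
  semigroup_at_infinity T !=set0 /\ compact (semigroup_at_infinity T).
Proof.
move=> H; split.
  have [|K [psi [spsi [L TL]]]] := H (sdir S) id; first by move=> s; exists s.
  by exists L; exact: subnet_limit TL.
move=> F FF FT.
(* A filter on the semigroup at infinity is turned into a net in [S]: an index is a triple
   [(s, A, e)] with [T s] within [e] of some point of the filter set [A]. Limits of subnets are then
   cluster points of [F]. *)
pose J := {p : S * set (bop E) * R | [/\ F p.1.2, 0 < p.2 &
  exists2 g, p.1.2 g & rnorm (g - T p.1.1) < p.2]}.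
pose le (p q : J) := [/\ sle (sval p).1.1 (sval q).1.1,
  (sval q).1.2 `<=` (sval p).1.2 & (sval q).2 <= (sval p).2].
have mk s0 A (e : R) : F A -> 0 < e -> exists2 p : J, sle s0 (sval p).1.1 &
    (sval p).1.2 = A /\ (sval p).2 = e.
  move=> FA e0; have [g [Ag Tg]] := filter_ex (filterI FA FT).
  have [s s0s gs] := (semigroup_at_infinityP g).1 Tg s0 e e0.
  by exists (exist _ (s, A, e) (And3 FA e0 (ex_intro2 _ _ g Ag gs))).
have J0 : inhabited J by have [p _ _] := mk 0 _ 1 FT ltr01; exists.
have le_refl p : le p p by split => //; exact: sle_refl.
have le_tr p q r : le p q -> le q r -> le p r.
  move=> [pq pqA pq2] [qr qrA qr2]; split; first exact: sle_trans qr.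
    exact: subset_trans pqA.
  exact: le_trans pq2.
have le_dir p q : exists r, le p r /\ le q r.
  have [k [pk qk]] := sle_directed (sval p).1.1 (sval q).1.1.
  have [Fp p0 _] := svalP p; have [Fq q0 _] := svalP q.
  have e0 : 0 < Num.min (sval p).2 (sval q).2 by rewrite lt_min p0.
  have [r kr [rA re]] := mk k _ _ (filterI Fp Fq) e0.
  exists r; split; split; rewrite ?re ?rA ?ge_min ?lexx ?orbT//; by
    [exact: sle_trans kr|exact: subIsetl|exact: subIsetr].
pose JD := DirectedType J0 le_refl le_tr le_dir.
pose phi (p : JD) : sdir S := (sval p).1.1.
have sphi : is_subnet phi.
  move=> s; have [p sp _] := mk s _ 1 FT ltr01.
  by exists p => q [pq _ _]; exact: sle_trans pq.
have [K [psi [spsi [L TL]]]] := H JD phi sphi.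
exists L; split; first by apply: subnet_limit TL; exact: subnet_comp spsi.
apply/cluster_rnormP => A e FA e0; have e2 : 0 < e / 2 by rewrite divr_gt0.
have [p _ [pA pe]] := mk 0 A (e / 2) FA e2.
have [k1 Hk1] := spsi p; have /cvg_rnormP/(_ _ e2)[k2 _ Hk2] := TL.
have [k [k1k k2k]] := dle_directed k1 k2.
have [_ sA se] := Hk1 k k1k; have := Hk2 k k2k.
have [_ _ [g gA gs]] := svalP (psi k); rewrite /= /phi => Lk.
exists g; first by rewrite -pA; exact: sA.
apply: le_lt_trans (rnorm_dist _ (T (sval (psi k)).1.1) _) _.
rewrite [e]splitr ltrD// rnormB_sym; apply: lt_le_trans gs _; by rewrite -pe.
Qed.

End Asymptotics.

(** * Convex hulls *)

Section ConvexHull.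
Context {R : realType}.
Local Notation C := R[i].

Lemma convex_setP (V : lmodType C) (K : set V) : @convex_set C V K <->
  forall (a : C) x y, 0 <= a -> a <= 1 -> K x -> K y -> K (a *: x + (1 - a) *: y).
Proof.
split=> [cK a x y a0 a1 Kx Ky|H x y a].
  have := cK x y (Itv01 a0 a1); rewrite !inE => /(_ Kx Ky).
  by [].
rewrite !inE => Kx Ky; exact: (H a%:num).
Qed.

Definition hull (V : lmodType C) (A : set V) : set V :=
  smallest (@convex_set C V) A.

Section lmod.
Variable V : lmodType C.
Implicit Types (A K : set V) (x y : V).

Lemma sub_hull A : A `<=` hull A. Proof. exact: sub_smallest. Qed.

Lemma hull_sub A K : @convex_set C V K -> A `<=` K -> hull A `<=` K.
Proof. exact: smallest_sub. Qed.

Lemma hull_convex A (a : C) x y : 0 <= a -> a <= 1 -> hull A x -> hull A y ->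
  hull A (a *: x + (1 - a) *: y).
Proof.
move=> a0 a1 Ax Ay K [cK AK].
have /convex_setP := cK; apply => //; [exact: Ax|exact: Ay].
Qed.

Lemma hullS A B : A `<=` B -> hull A `<=` hull B.
Proof.
move=> AB; apply: hull_sub; last exact: subset_trans AB (@sub_hull B).
by apply/convex_setP => a x y; exact: hull_convex.
Qed.

Lemma hull_average A n (x : nat -> V) : (forall k, hull A (x k)) ->
  hull A (n.+1%:R^-1 *: \sum_(k < n.+1) x k).
Proof.
move=> Ax; elim: n => [|n ih]; first by rewrite big_ord1 invr1 scale1r.
have n0 : n.+1%:R != 0 :> C by rewrite pnatr_eq0.
have m0 : n.+2%:R != 0 :> C by rewrite pnatr_eq0.
have a0 : 0 <= n.+1%:R / n.+2%:R :> C by rewrite divr_ge0.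
have a1 : n.+1%:R / n.+2%:R <= 1 :> C by rewrite ler_pdivrMr ?ltr0n// mul1r ler_nat.
have := hull_convex a0 a1 ih (Ax n.+1); rewrite scalerA mulrAC mulfV// mul1r.
have -> : 1 - n.+1%:R / n.+2%:R = n.+2%:R^-1 :> C.
  by apply: (mulIf m0); rewrite mulrBl mulVf// divfK// mul1r -natrB// subSnn.
by rewrite -scalerDr [in X in _ -> X]big_ord_recr.
Qed.

End lmod.

Lemma rnorm_unit_interval (a : C) : 0 <= a -> a <= 1 -> rnorm a + rnorm (1 - a) = 1.
Proof.
move=> a0 a1; rewrite /rnorm !ger0_norm ?subr_ge0// -Re_addc addrC subrK.
by [].
Qed.

Lemma rnorm_convex (V : normedModType C) (a : C) (x y : V) (c : R) : 0 <= a -> a <= 1 ->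
  rnorm x <= c -> rnorm y <= c -> rnorm (a *: x + (1 - a) *: y) <= c.
Proof.
move=> a0 a1 xc yc; apply: (le_trans (rnormD _ _)); rewrite !rnormZ.
rewrite -[c]mul1r -(rnorm_unit_interval a0 a1) mulrDl.
by rewrite lerD// ler_wpM2l ?rnorm_ge0.
Qed.

Lemma convexB (V : lmodType C) (a : C) (x y x' y' : V) :
  (a *: x + (1 - a) *: y) - (a *: x' + (1 - a) *: y') =
  a *: (x - x') + (1 - a) *: (y - y').
Proof. by rewrite !scalerBr opprD addrACA. Qed.

Lemma convex_id (V : lmodType C) (a : C) (x : V) : a *: x + (1 - a) *: x = x.
Proof. by rewrite -scalerDl addrC subrK scale1r. Qed.

Lemma compact_finite_net (X : normedModType C) (K : set X) : compact K ->
  forall e : R, 0 < e -> exists l : seq X, forall x, K x ->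
    exists2 y, y \in l & rnorm (x - y) < e.
Proof.
rewrite compact_cover => cK e e0.
have [||D _ KD] := cK X setT (fun y => interior [set x | rnorm (x - y) < e]).
- by move=> y _; exact: open_interior.
- move=> x _; exists x => //; apply/nbhs_rnormP; exists e => // y.
  by rewrite rnormB_sym.
- exists (finmap.enum_fset D) => x /KD[y yD /interior_subset xy].
  by exists y.
Qed.

(** The combinations of [l] with coefficients in the disc form a compact convex set. Its
    closed-distance [e] neighbourhood is convex and contains [A], hence the hull; a net of mesh
    [d - e] of the compact set finishes. *)
Lemma compact_image_hull_net (X : normedModType C) (A : set X) (e : R) (l : seq X) :
  (forall x, A x -> exists2 y, y \in l & rnorm (x - y) <= e) ->
  forall d : R, e < d -> exists m : seq X, forall x, hull A x ->
    exists2 y, y \in m & rnorm (x - y) < d.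
Proof.
move=> Al d ed; pose Q (k : 'I_(size l)) := tnth (in_tuple l) k.
pose K := [set \sum_k z k *: Q k | z in [set z : 'I_(size l) -> C |
  forall k, rnorm (z k) <= 1]].
have AK : hull A `<=` [set x | exists2 y, K y & rnorm (x - y) <= e].
  apply: hull_sub.
    apply/convex_setP => a x x' a0 a1 [_ [z z1 <-] xz] [_ [w w1 <-] xw].
    exists (\sum_k (a * z k + (1 - a) * w k) *: Q k).
      exists (fun k => a * z k + (1 - a) * w k) => // k.
      exact: (@rnorm_convex C^o).
    under eq_bigr do rewrite scalerDl -!scalerA.
    rewrite big_split /= -!scaler_sumr convexB; exact: rnorm_convex.
  move=> x Ax; have [y yl xy] := Al x Ax; exists y => //.
  have /tnthP[k yk] : y \in in_tuple l by [].
  exists (fun j => if j == k then 1 else 0) => [j|].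
    by case: ifP; rewrite ?rnorm1 ?rnorm0.
  rewrite (bigD1 k)//= eqxx scale1r big1 ?addr0// => j /negPf ->.
  by rewrite scale0r.
have de : 0 < d - e by rewrite subr_gt0.
have [m Hm] := compact_finite_net (@compact_span R X _ Q _ compact_disc) de.
exists m => x /AK[y Ky xy]; have [u um yu] := Hm y Ky; exists u => //.
by apply: le_lt_trans (rnorm_dist _ y _) _; lra.
Qed.

Lemma ultra_finite_cover (X : Type) (Y : eqType) (U : set_system X) (l : seq Y)
    (P : Y -> set X) : UltraFilter U ->
  U [set x | exists2 y, y \in l & P y x] -> exists2 y, y \in l & U (P y).
Proof.
move=> UU; elim: l => [|y l ih] H.
  have PU := @ultra_proper _ _ UU.
  by have [x [?]] := filter_ex H.
have [UP|UN] := in_ultra_setVsetC (P y) UU; first by exists y; rewrite ?mem_head.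
have [|u ul uU] := ih; last by exists u; rewrite // inE ul orbT.
have PU := @ultra_proper _ _ UU.
apply: filterS2 UN H => x nPy [u]; rewrite inE => /orP[/eqP ->//|ul Pu].
by exists u.
Qed.

Variable E : normedModType C.

(** Both sides are affine and continuous in [Q]. This one form covers the commutation and absorption
    identities of the mean ergodic projection. *)
Lemma affine_hull_closure (A : set (bop E)) (B B' D D' F : bop E) :
  (forall Q, A Q -> B * Q * B' = D * Q * D' + F) ->
  forall Q, closure (hull A) Q -> B * Q * B' = D * Q * D' + F.
Proof.
move=> HA Q AQ.
have {}HA Y : hull A Y -> B * Y * B' = D * Y * D' + F.
  apply: (@hull_sub _ A [set Y | B * Y * B' = D * Y * D' + F]) => //.
  apply/convex_setP => a x y a0 a1 /= Hx Hy.
  rewrite !mulrDr !mulrDl !bop_scaleAr !bop_scaleAl Hx Hy !scalerDr addrACA.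
  by rewrite convex_id.
apply/eqP; rewrite -subr_eq0; apply/eqP/rnorm_small0 => e e0.
pose c := rnorm B * rnorm B' + rnorm D * rnorm D'.
have c0 : 0 <= c by rewrite addr_ge0// mulr_ge0// rnorm_ge0.
have c1 : 0 < c + 1 by rewrite ltr_wpDl.
have /closure_rnormP/(_ _ (divr_gt0 e0 c1))[Y AY QY] := AQ.
have -> : B * Q * B' - (D * Q * D' + F) = B * (Q - Y) * B' - D * (Q - Y) * D'.
  rewrite !mulrBr !mulrBl (HA Y AY) opprB (addrC _ F) opprD addrA (addrC _ F).
  by rewrite opprD (addrA (B * Q * B')) subrKA.
have mul3 (a b b' : bop E) : rnorm (b * a * b') <= rnorm b * rnorm b' * rnorm a.
  apply: (le_trans (rnorm_bopM _ _)); rewrite mulrAC.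
  by rewrite ler_wpM2r ?rnorm_ge0// rnorm_bopM.
apply: (le_trans (rnormB _ _)).
apply: (@le_trans _ _ (c * rnorm (Q - Y))); first by rewrite mulrDl lerD.
apply: (@le_trans _ _ ((c + 1) * rnorm (Q - Y))).
  by rewrite ler_wpM2r ?rnorm_ge0// lerDl.
by rewrite mulrC -ler_pdivlMr// ltW.
Qed.

End ConvexHull.

(** * Uniform mean ergodicity *)

Section MeanErgodic.
Context {R : realType} {S : nmodType}.
Local Notation C := R[i].

(** Total boundedness of tails, where the tail may depend on [e]. *)
Definition eventual_finite_net (E : normedModType C) (T : S -> bop E) :=
  forall e : R, 0 < e -> exists (l : seq (bop E)) (s0 : S), forall s, sle s0 s ->
    exists2 f, f \in l & rnorm (T s - f) < e.

Section twist.
Variable E : normedModType C.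
Variable T : S -> bop E.

Lemma dist0_finite_net (A : set (bop E)) : A !=set0 -> compact (closure A) ->
  set_dist (T s) A @[s --> eventually_in (sdir S)] --> (0 : R) -> eventual_finite_net T.
Proof.
move=> A0 cA /(@set_dist_cvg0 R (bop E) (sdir S) T A A0) TA e e0.
have e2 : 0 < e / 2 by rewrite divr_gt0.
have [l Hl] := compact_finite_net cA e2; have [s0 _ Hs] := TA _ e2.
exists l, s0 => s s0s; have [a Aa sa] := Hs s s0s.
have [f fl af] := Hl a (subset_closure Aa); exists f => //.
by apply: le_lt_trans (rnorm_dist _ a _) _; rewrite [e]splitr ltrD.
Qed.

Lemma twist_representation (z : S -> C) :
  representation T -> unitary_character z -> representation (twist z T).
Proof.
move=> [TD T0] [_ zD z0]; split => [s t|]; last by rewrite /twist z0 T0 scale1r.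
by rewrite /twist zD TD bop_scaleAl bop_scaleAr scalerA.
Qed.

Lemma rnorm_twist (z : S -> C) s : unitary_character z -> rnorm (twist z T s) = rnorm (T s).
Proof. by move=> [z1 _ _]; rewrite rnormZ (unimodularE _).1// mul1r. Qed.

(** A finite net of the circle is multiplied with one for [T]. *)
Lemma twist_finite_net (z : S -> C) :
  unitary_character z -> eventual_finite_net T -> eventual_finite_net (twist z T).
Proof.
move=> [z1 _ _] Tn e e0; have e2 : 0 < e / 2 by rewrite divr_gt0.
have [l [s0 Hl]] := Tn _ e2.
have [K K0 lK] : exists2 K : R, 0 < K & forall f, f \in l -> rnorm f <= K.
  exists (1 + \sum_(f <- l) rnorm f) => [|f fl].
    by rewrite ltr_pwDl// sumr_ge0// => f _; exact: rnorm_ge0.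
  rewrite (big_rem f)//= addrCA lerDl addr_ge0// sumr_ge0// => g _.
  exact: rnorm_ge0.
have [m Hm] := compact_finite_net (@compact_circle R) (divr_gt0 e2 K0).
exists [seq c *: f | c <- m, f <- l], s0 => s s0s.
have [f fl sf] := Hl s s0s; have [c cm zc] := Hm (z s) ((unimodularE _).1 (z1 s)).
exists (c *: f); first by apply/allpairsP; exists (c, f).
have -> : twist z T s - c *: f = z s *: (T s - f) + (z s - c) *: f.
  by rewrite /twist scalerBr scalerBl subrKA.
apply: (le_lt_trans (rnormD _ _)); rewrite !rnormZ (unimodularE _).1// mul1r [e]splitr.
rewrite ltr_leD//; apply: (@le_trans _ _ (rnorm (z s - c) * K)).
  by rewrite ler_wpM2l ?rnorm_ge0 ?lK.
by rewrite -ler_pdivlMr// ltW.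
Qed.
End twist.

Section projection.
Variable E : normedModType C.
Variable T : S -> bop E.
Hypothesis Trep : representation T.
Variable M : R.
Hypothesis TM : forall s, rnorm (T s) <= M.

Let tail (t : S) := [set T s | s in [set s | sle t s]].

Lemma tail_hull_norm t Y : hull (tail t) Y -> rnorm Y <= M.
Proof.
apply: (@hull_sub _ _ _ [set Y : bop E | rnorm Y <= M]); last by move=> _ [s _ <-] /=.
by apply/convex_setP => a x y; exact: rnorm_convex.
Qed.

Lemma tail_hullM t u Y : hull (tail t) Y -> hull (tail t) (T u * Y).
Proof.
apply: (@hull_sub _ _ _ [set Y : bop E | hull (tail t) (T u * Y)]).
  apply/convex_setP => a x y a0 a1 /= Hx Hy.
  by rewrite mulrDr !bop_scaleAr; exact: hull_convex.
move=> _ [s ts <-] /=; apply: sub_hull; exists (u + s); last by rewrite Trep.1.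
by apply: sle_trans ts _; exists u; rewrite addrC.
Qed.

(* Cesaro averaging along each of the finitely many [s \in l] in turn. *)
Lemma almost_invariant (l : seq S) t (e : R) : 0 < e ->
  exists2 Y, hull (tail t) Y & forall s, s \in l -> rnorm (Y - T s * Y) <= e.
Proof.
have M0 := rep_bound_ge0 TM; have M1 : 0 < M + 1 by rewrite ltr_wpDl.
elim: l e => [|s l ih] e e0.
  by exists (T t) => //; apply: sub_hull; exists t => //; exact: sle_refl.
have [Y tY lY] := ih _ (divr_gt0 e0 M1).
(* The sum telescopes to a difference of two terms of norm at most [M], so the average has error at
   most [2 * M / n.+1]. *)
pose n := Num.bound (2 * M / e).
have ne : 2 * M <= n.+1%:R * e.
  rewrite -ler_pdivrMr//; apply: (@le_trans _ _ n%:R); last by rewrite ler_nat.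
  by rewrite ltW// archi_boundP// divr_ge0 ?mulr_ge0// ltW.
have n0 : 0 < n.+1%:R :> R by rewrite ltr0n.
have nV : rnorm (n.+1%:R^-1 : C) = n.+1%:R^-1.
  have := rnormM (n.+1%:R^-1 : C) n.+1%:R; rewrite mulVf ?pnatr_eq0// rnorm1 rnorm_nat.
  by move=> /esym H; apply: (mulIf (lt0r_neq0 n0)); rewrite H mulVf// lt0r_neq0.
pose x k := T (s *+ k) * Y.
exists (n.+1%:R^-1 *: \sum_(k < n.+1) x k).
  by apply: hull_average => k; exact: tail_hullM.
move=> u; rewrite inE bop_scaleAr -scalerBr rnormZ nV ler_pdivrMl// => /orP[/eqP ->|ul].
  have -> : \sum_(k < n.+1) x k - T s * \sum_(k < n.+1) x k = Y - x n.+1.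
    rewrite mulr_sumr -sumrB; under eq_bigr do rewrite /x mulrA -Trep.1 -mulrS -/(x _).
    rewrite -(big_mkord xpredT (fun k => x k - x k.+1)).
    under eq_bigr do rewrite -opprB; rewrite sumrN telescope_sumr// opprB.
    by rewrite /x mulr0n Trep.2 mul1r.
  apply: le_trans ne; apply: (le_trans (rnormB _ _)).
  by rewrite mulr_natl mulr2n lerD// (@tail_hull_norm t)//; exact: tail_hullM.
(* For the earlier [u], commutation shows that each summand multiplies the old error by at most
   [M]. *)
rewrite mulr_sumr -sumrB; apply: (le_trans (rnorm_sum _ _ _)).
rewrite mulr_natl -[X in _ *+ X]card_ord -sumr_const ler_sum// => k _.
rewrite /x mulrA (rep_comm Trep) -mulrA -mulrBr; apply: (le_trans (rnorm_bopM _ _)).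
apply: (@le_trans _ _ ((M + 1) * (e / (M + 1)))); last by rewrite mulrC divfK// gt_eqF.
by rewrite ler_pM ?rnorm_ge0 ?lY//; apply: le_trans (TM _) _; rewrite lerDl.
Qed.

End projection.

(** An ultrafilter of almost invariant elements of tail hulls selects one ball from each finite net,
    so it is Cauchy; its limit is the projection. *)
Lemma finite_net_mean_ergodic (E : completeNormedModType C) (T : S -> bop E) (M : R) :
  representation T -> (forall s, rnorm (T s) <= M) -> eventual_finite_net T ->
  uniformly_mean_ergodic T.
Proof.
move=> Trep TM Tnet; have M0 := rep_bound_ge0 TM.
pose tail (t : S) := [set T s | s in [set s | sle t s]].
have tailS s t : sle s t -> hull (tail t) `<=` hull (tail s).
  by move=> st; apply: hullS => _ [u tu <-]; exists u => //; exact: sle_trans tu.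
pose G := filter_from [set p : seq S * R * S | 0 < p.1.2]
  (fun p => [set Y | hull (tail p.2) Y /\ forall s, s \in p.1.1 -> rnorm (Y - T s * Y) <= p.1.2]).
have GG : ProperFilter G.
  apply: filter_from_proper => [|[[l e] t] e0]; last first.
    by have [Y tY lY] := almost_invariant Trep TM l t e0; exists Y.
  apply: filter_from_filter; first by exists ([::], 1, 0); exact: ltr01.
  move=> [[l d] t] [[m e] u] /= d0 e0; exists (l ++ m, Num.min d e, t + u) => /=.
    by rewrite lt_min d0.
  move=> Y [tY HY]; split; split.
  - by apply: tailS tY; exists u.
  - move=> s sl; have := HY s; rewrite mem_cat sl => /(_ isT).
    by rewrite le_min => /andP[].
  - by apply: tailS tY; exists t; rewrite addrC.
  - move=> s sl; have := HY s; rewrite mem_cat sl orbT => /(_ isT).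
    by rewrite le_min => /andP[].
have [U [UU GU]] := ultraFilterLemma GG; have PU := @ultra_proper _ _ UU.
have [|P UP] := @bop_complete R E U PU.
  move=> e e0; have e2 : 0 < e / 2 by rewrite divr_gt0.
  have e2e : e / 2 < e by lra.
  have [l [s0 Hl]] := Tnet _ e2.
  have [|m Hm] := @compact_image_hull_net R (bop E) (tail s0) (e / 2) l _ e e2e.
  - by move=> _ [s s0s <-]; have [f fl /ltW sf] := Hl s s0s; exists f.
  - have [|f _ Uf] := @ultra_finite_cover _ _ U m (fun f => [set Y : bop E | rnorm (f - Y) < e]) UU.
      apply: GU; exists ([::], 1, s0); first exact: ltr01.
      move=> Y [Y0 _]; have [f fm Yf] := Hm Y Y0.
      by exists f => //; rewrite /= rnormB_sym.
    by exists f.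
have Pnear (l : seq S) t (e : R) : 0 < e -> exists Y, [/\ hull (tail t) Y,
    forall s, s \in l -> rnorm (Y - T s * Y) <= e & rnorm (P - Y) < e].
  move=> e0; have /cvg_rnormP/(_ e e0) UPe := UP.
  have : U [set Y | hull (tail t) Y /\ forall s, s \in l -> rnorm (Y - T s * Y) <= e].
    by apply: GU; exists (l, e, t).
  by move=> /(filterI UPe)/filter_ex[Y [PY [tY lY]]]; exists Y.
have TP s : T s * P = P.
  apply/esym/eqP; rewrite -subr_eq0; apply/eqP/rnorm_small0 => e e0.
  have M2 : 0 < M + 2 by rewrite ltr_wpDl.
  have [Y [_ sY PY]] := Pnear [:: s] 0 _ (divr_gt0 e0 M2).
  have {}sY := sY s (mem_head _ _).
  have -> : P - T s * P = (P - Y) + (Y - T s * Y) - T s * (P - Y).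
    by rewrite mulrBr opprB subrKA addrC subrKA addrC.
  apply: (le_trans (rnormB _ _)).
  have := rnormD (P - Y) (Y - T s * Y).
  have : rnorm (T s * (P - Y)) <= M * (e / (M + 2)).
    by apply: (le_trans (rnorm_bopM _ _)); rewrite ler_pM ?rnorm_ge0// ltW.
  have -> : M * (e / (M + 2)) = e - 2 * (e / (M + 2)) by field; rewrite gt_eqF.
  move: PY; lra.
have Phull : closed_convex_hull (range T) P.
  apply/closure_rnormP => e e0; have [Y [tY _ PY]] := Pnear [::] 0 e e0.
  by exists Y => //; apply: (hullS _ tY) => _ [s _ <-]; exists s.
(* Elements of the closed hull commute with [T s], so [TP] also gives absorption on the other
   side. *)
have PT s : P * T s = P.
  have := @affine_hull_closure R E (range T) 1 (T s) (T s) 1 0 _ P Phull.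
  rewrite !mul1r !mulr1 addr0 TP; apply => _ [t _ <-].
  by rewrite !mul1r mulr1 addr0 (rep_comm Trep).
exists P => // Q HQ; split.
  have := @affine_hull_closure R E (range T) 1 P 0 0 P _ Q HQ.
  by rewrite mul1r mul0r mul0r add0r; apply => _ [t _ <-]; rewrite mul1r TP mul0r mul0r add0r.
have := @affine_hull_closure R E (range T) P 1 0 0 P _ Q HQ.
by rewrite mulr1 mul0r mul0r add0r; apply => _ [t _ <-]; rewrite mulr1 PT mul0r mul0r add0r.
Qed.

Lemma smallest_left_ideal (A : pzRingType) (G : set A) :
  left_ideal (smallest (@left_ideal A) G).
Proof.
split=> [I [[I0 _ _] _]//|x y Ix Iy I HI|a x Ix I HI].
  by have [_ ID _] := HI.1; apply: ID; [exact: Ix|exact: Iy].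
by have [_ _ IM] := HI.1; apply: IM; exact: Ix.
Qed.

(* On [ker P] the operator [1 - Y], for [Y] in the convex hull near [P], lies in the left
   ideal; it agrees there with [1 - (Y - P)(1 - P)], which is inverted on all of [E]. *)
Lemma mean_ergodic_pole (E : completeNormedModType C) (T : S -> bop E) (z : S -> C) :
  representation T -> unitary_character z ->
  uniformly_mean_ergodic (twist (fun s => (z s)^-1) T) -> pole T z.
Proof.
move=> Trep uz [P Phull PQ]; have [z1 _ _] := uz.
have z0 s : z s != 0 by rewrite -normr_eq0 z1 oner_eq0.
have sub_closed (A : set (bop E)) : A `<=` closure (hull A).
  by move=> f Af; apply: subset_closure; exact: sub_hull.
have TPP s : z s *: P = T s * P /\ z s *: P = P * T s.
  have := PQ (twist (fun s => (z s)^-1) T s); rewrite /twist bop_scaleAl bop_scaleAr.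
  have H : closed_convex_hull (range (twist (fun s => (z s)^-1) T)) ((z s)^-1 *: T s).
    by apply: sub_closed; exists s.
  move=> /(_ H)[H1 H2]; split; [rewrite -[in LHS]H1|rewrite -[in LHS]H2];
    by rewrite scalerA mulfV// scale1r.
have PT s : P * T s = T s * P by have [<- <-] := TPP s.
split => //; exists P; split.
- by have [] := PQ P Phull.
- apply/seteqP; split => [_ [x _ <-] s|x zx].
    by rewrite -bop_mulE; have [<- _] := TPP s.
  exists x => //; apply/eqP; rewrite -subr_eq0; apply/eqP/rnorm_small0 => e e0.
  have x1 : 0 < rnorm x + 1 by rewrite ltr_wpDl ?rnorm_ge0.
  have /closure_rnormP/(_ _ (divr_gt0 e0 x1))[Y HY PY] := Phull.
  have Yx : Y x = x.
    apply: (@hull_sub _ _ _ [set Y : bop E | Y x = x] _ _ _ HY).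
      apply/convex_setP => a f g a0 a1 /= fx gx.
      by change (a *: f x + (1 - a) *: g x = x); rewrite fx gx convex_id.
    by move=> _ [s _ <-]; change ((z s)^-1 *: T s x = x); rewrite zx scalerA mulVf// scale1r.
  rewrite -{2}Yx -bop_subE; apply: (le_trans (rnorm_bop _ _)).
  apply: (@le_trans _ _ (rnorm (P - Y) * (rnorm x + 1))).
    by rewrite ler_wpM2l ?rnorm_ge0// lerDl.
  by rewrite -ler_pdivlMr// ltW.
exists PT => -[_]; apply; pose X := subsp (ker_op P).
pose I := smallest (@left_ideal (bop X))
  (range (fun s => z s *: (1 : bop X) - restr_rep (ker_invariant PT) s)).
have [I0 ID IM] : left_ideal I by exact: smallest_left_ideal.
have IZ (a : C) J : I J -> I (a *: J).
  by move=> IJ; have := IM (a *: (1 : bop X)) J IJ; rewrite bop_scaleAl mul1r.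
(* For each generator [1 - (z s)^-1 *: T s] is in the ideal, and [1 - Y] is a convex combination of
   such operators on [ker P]. *)
have HI Y : hull (range (twist (fun s => (z s)^-1) T)) Y -> exists J : bop X, I J /\
    forall x : X, subsp_val (J x) = subsp_val x - Y (subsp_val x).
  apply: (@hull_sub _ _ _ [set Y : bop E | exists J : bop X, I J /\
    forall x : X, subsp_val (J x) = subsp_val x - Y (subsp_val x)]).
    apply/convex_setP => a f g a0 a1 [J [IJ JE]] [K [IK KE]].
    exists (a *: J + (1 - a) *: K); split => [|x]; first by apply: ID; exact: IZ.
    change (a *: subsp_val (J x) + (1 - a) *: subsp_val (K x) =
      subsp_val x - (a *: f (subsp_val x) + (1 - a) *: g (subsp_val x))).
    by rewrite JE KE -convexB convex_id.
  move=> _ [s _ <-] /=.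
  exists ((z s)^-1 *: (z s *: (1 : bop X) - restr_rep (ker_invariant PT) s)); split => [|x].
    by apply: IZ; apply: (sub_smallest (@subset_refl _ _)); exists s.
  change ((z s)^-1 *: (z s *: subsp_val x - T s (subsp_val x)) =
    subsp_val x - (z s)^-1 *: T s (subsp_val x)).
  by rewrite scalerBr scalerA mulVf// scale1r.
pose c := rnorm (1 - P); have c0 : 0 <= c := rnorm_ge0 _.
(* This distance from [Y] to [P] makes the norm of [(Y - P) * (1 - P)] at most 1/2. *)
have d0 : 0 < 1 / 2 / (c + 1) by rewrite !divr_gt0// ltr_wpDl.
have /closure_rnormP/(_ _ d0)[Y HY PY] := Phull.
have [J [IJ JE]] := HI Y HY.
have [|W WZ] := @neumann_inverse R E ((Y - P) * (1 - P)).
  apply: (le_trans (rnorm_bopM _ _)); rewrite rnormB_sym.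
  apply: (@le_trans _ _ (rnorm (P - Y) * (c + 1))).
    by rewrite ler_wpM2l ?rnorm_ge0// lerDl.
  by rewrite -ler_pdivlMr ?ltW// ltr_wpDl.
have P1 x : P ((1 - P) x) = 0.
  have [PP _] := PQ P Phull.
  by rewrite bop_subE bop_oneE bopB -bop_mulE PP subrr.
(* The inverse [W] need not preserve [ker P], so it is followed by the projection [1 - P] onto
   it. *)
have WF x : csub (ker_op P) x -> csub (ker_op P) (((1 - P) * W) x).
  by move=> _; exact: P1.
have WJ : restr WF * J = 1.
  apply: bop_eqP => x; apply: val_inj.
  change ((1 - P) (W (subsp_val (J x))) = subsp_val x).
  have Px : P (subsp_val x) = 0 := subspP x.
  have -> : subsp_val (J x) = (1 - (Y - P) * (1 - P)) (subsp_val x).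
    rewrite JE bop_subE bop_mulE (bop_subE 1) bop_oneE Px subr0 (bop_subE Y).
    by rewrite Px subr0.
  by rewrite -(bop_mulE W) WZ bop_oneE bop_subE Px subr0.
have I1 : I 1 by rewrite -WJ; exact: IM.
by apply/seteqP; split => // a _; rewrite -[a]mulr1; exact: IM a 1 I1.
Qed.

End MeanErgodic.

(** * Assembly of the equivalences *)

Lemma bounded_fun_rnorm (R : realType) (S : Type) (E : normedModType R[i]) (T : S -> bop E) :
  bounded_fun T -> exists M : R, forall s, rnorm (T s) <= M.
Proof.
(* [bounded_fun] provides the bounds strictly above [M], whence [M + 1]. *)
move=> [M [Mreal HM]]; exists (complex.Re (M + 1)) => s.
by apply: Re_lec; apply: HM => //; rewrite ltrDl.
Qed.

Lemma unitary_characterV (R : realType) (S : nmodType) (z : S -> R[i]) :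
  unitary_character z -> unitary_character (fun s => (z s)^-1).
Proof.
move=> [z1 zD z0]; split => [s|s t|]; last by rewrite z0 invr1.
  by rewrite normfV z1 invr1.
by rewrite zD invfM.
Qed.

Theorem theorem3p9 (R : realType) (S : nmodType)
    (E : completeNormedModType R[i]) (T : S -> bop E)
    (Trep : representation T) (Tbounded : bounded_fun T) :
  [<-> (* (a) *)
       semigroup_at_infinity T !=set0 /\ compact (semigroup_at_infinity T);
       (* (b) *)
       forall (J : directedType) (phi : J -> sdir S), is_subnet phi ->
         exists (K : directedType) (psi : K -> J), is_subnet psi /\
           exists L : bop E, T (phi (psi k)) @[k --> eventually_in K] --> L;
       (* (c) *)
       exists I : set (bop E),
         semigroup_ideal (closure (range T)) I /\ compact I;
       (* (d) *)
       exists A : set (bop E), [/\ A !=set0, compact (closure A) &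
         set_dist (T s) A @[s --> eventually_in (sdir S)] --> (0 : R)];
       (* (e) *)
       totally_uniformly_mean_ergodic T;
       (* (f) *)
       sigma_uni T `<=` [set chi | pole T chi];
       (* (g) *)
       exists Er Es : closed_subspace E,
         [/\ is_direct_sum [set: E] (fun b : bool => if b then csub Er else csub Es),
             rep_invariant T Er,
             exists (n : nat) (chi : 'I_n -> S -> R[i]),
               (forall k, unitary_character (chi k)) /\
               is_direct_sum Er (fun k => ker_char (chi k) T) &
             exists TEs : rep_invariant T Es,
               restr_rep TEs s @[s --> eventually_in (sdir S)] -->
                 (0 : bop (subsp Es))]].
Proof.
have [M TM] := bounded_fun_rnorm Tbounded.
have ac : semigroup_at_infinity T !=set0 /\ compact (semigroup_at_infinity T) ->
    exists I : set (bop E), semigroup_ideal (closure (range T)) I /\ compact I.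
  move=> [Tn0 cT]; exists (semigroup_at_infinity T); split => //.
  exact (semigroup_at_infinity_ideal Trep TM Tn0).
have cd : (exists I : set (bop E), semigroup_ideal (closure (range T)) I /\ compact I) ->
    exists A : set (bop E), [/\ A !=set0, compact (closure A) &
      set_dist (T s) A @[s --> eventually_in (sdir S)] --> (0 : R)].
  by move=> [I [iI cI]]; exact (compact_ideal_dist0 Trep TM iI cI).
have ba := @subnets_compact_at_infinity R S E T.
(* The cycle follows the listed order: (a) reaches (b) through (c) and (d), (b) reaches (c) through
   (a), and (g) returns to (a) through (d) and (b). *)
tfae.
- move=> /ac/cd[A [A0 cA TA]]; exact (dist0_subnet A0 cA TA).
- by move=> /ba/ac.
- exact: cd.
- move=> [A [A0 cA TA]] z uz.
  apply: (@finite_net_mean_ergodic R S E _ M).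
  + exact: twist_representation.
  + by move=> s; rewrite rnorm_twist.
  + by apply: twist_finite_net => //; exact (dist0_finite_net A0 cA TA).
- move=> Tume z [uz _]; apply: mean_ergodic_pole => //.
  exact/Tume/unitary_characterV.
- exact (poles_decomposition Trep TM).
- move=> [Er [Es [ET _ [n [chi [uchi Er_eq]]] [TEs Tcvg]]]]; apply: ba.
  have [A [A0 cA TA]] := decomposition_dist0 TM ET uchi Er_eq Tcvg.
  exact (dist0_subnet A0 cA TA).
Qed.
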